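(* Let $G$ be the free group freely generated by a finite non-empty set $S_0$. If $\mathcal{G}$ is a minimal Rauzy graph (for $G$) on a non-degenerate partition $A$ of $\Omega$, then the set $\mathcal{N}_{\mathrm{min}}(\mathcal{G})$ is non-empty. Moreover, the collection $$\{\mathcal{N}_{\mathrm{min}}(\mathcal{G}) : A \text{ is a non-degenerate partition of } \Omega \text{ and } \mathcal{G} \text{ is a minimal Rauzy graph on } A\}$$ forms a basis of open sets of the space $\Xi_{\mathrm{min}}(G)$.
   Context: $\Omega$ denotes the Cantor space; $\mathrm{Homeo}(\Omega)$ carries the uniform convergence topology. $\Xi(G)=\mathrm{Hom}(G,\mathrm{Homeo}(\Omega))$ is the Polish space of actions of $G$ on $\Omega$ by homeomorphisms, a closed subspace of $\mathrm{Homeo}(\Omega)^G$, and $\Xi_{\mathrm{min}}(G)$ is the subspace of minimal actions (no proper non-empty closed invariant subset). A non-degenerate partition of $\Omega$ is a finite partition of $\Omega$ into non-empty clopen sets. Let $S=S_0\cup S_0^{-1}$. A Rauzy graph (for $G$) is a tuple $\mathcal{G}=(V,E,\sigma,\rho,\ell,\bar{\cdot})$, where $V$ is a set of vertices, $E$ a set of edges, $\sigma,\rho\colon E\to V$ are the source and range maps, $\ell\colon E\to S$ is a labeling, and $\bar{\cdot}\colon E\to E$ is an involution, such that for all $e\in E$: $\sigma(\bar e)=\rho(e)$, $\rho(\bar e)=\sigma(e)$; $\ell(\bar e)=\ell(e)^{-1}$; the map $e\mapsto(\sigma(e),\rho(e),\ell(e))$ is injective; and for every $v\in V$ and $s\in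 S$ there exists $e\in E$ with $\sigma(e)=v$ and $\ell(e)=s$. Since an edge is determined by its source, range and label, a Rauzy graph is given by its vertices and the relations $v_1\xrightarrow{s}v_2$ (there is an edge labeled $s$ from $v_1$ to $v_2$). A Rauzy graph on $A$ is a Rauzy graph with vertex set $A$. A reduced path in $\mathcal{G}$ is a sequence of edges $(e_0,\dots,e_n)$ such that $\rho(e_i)=\sigma(e_{i+1})$ and $\ell(e_i)\neq\ell(e_{i+1})^{-1}$ for all $i<n$. $\mathcal{G}$ is minimal if for all edges $e,f$ there is a reduced path whose first edge is $e$ and whose last edge is $f$ or $\bar f$. For $\xi\in\Xi(G)$ and a non-degenerate partition $A$, $\mathcal{G}(\xi,A)$ is the Rauzy graph on $A$ defined by $a\xrightarrow{s}b\iff a\cap\xi(s)\cdot b\neq\emptyset$ for $a,b\in A$, $s\in S$. For a Rauzy graph $\mathcal{G}$ on $A$, $\mathcal{N}(\mathcal{G})=\{\xi\in\Xi(G):\mathcal{G}(\xi,A)=\mathcal{G}\}$ and $\mathcal{N}_{\mathrm{min}}(\mathcal{G})=\mathcal{N}(\mathcal{G})\cap\Xi_{\mathrm{min}}(G)$. *)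

(* Defs.v *)
From HB Require Import structures.
From mathcomp Require Import all_boot.
From mathcomp Require Import boolp classical_sets functions cardinality.
From mathcomp Require Import topology cantor.

Set Implicit Arguments.
Unset Strict Implicit.
Unset Printing Implicit Defensive.

Local Open Scope classical_set_scope.
Local Open Scope group_scope.

(* [S0] is a free generating set of [G], by the universal property; since [S0]
   is a subset of [G], the map [S0 -> G] is the inclusion. *)
Definition freely_generated_by (G : groupType) (S0 : set G) : Prop :=
  forall (H : groupType) (f : S0 -> H),
    exists! phi : G -> H,
      monoid_morphism phi /\ forall s : S0, phi (set_val s) = f s.

Definition sym_gens (G : groupType) (S0 : set G) : set G :=
  S0 `|` [set s^-1 | s in S0].

Notation Omega := cantor_space.

Record homeo : Type := Homeo {
  homeo_fun :> Omega -> Omega;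
  homeo_inv : Omega -> Omega;
  homeo_funK : cancel homeo_fun homeo_inv;
  homeo_invK : cancel homeo_inv homeo_fun;
  homeo_fun_continuous : continuous homeo_fun;
  homeo_inv_continuous : continuous homeo_inv }.

Lemma homeoP (f g : homeo) : homeo_fun f =1 homeo_fun g -> f = g.
Proof.
case: f g => [f fi fK fiK fc fic] [g gi gK giK gc gic] /= /funext fg.
subst g; have gifi : gi = fi by apply/funext => x; rewrite -{1}(fiK x) gK.
by subst gi; congr Homeo; exact: Prop_irrelevance.
Qed.

HB.instance Definition _ := gen_eqMixin homeo.
HB.instance Definition _ := gen_choiceMixin homeo.

Definition homeo_one : homeo :=
  @Homeo idfun idfun (fun=> erefl) (fun=> erefl)
    (fun=> cvg_id) (fun=> cvg_id).

Definition homeo_opp (f : homeo) : homeo :=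
  Homeo (homeo_invK f) (homeo_funK f)
    (@homeo_inv_continuous f) (@homeo_fun_continuous f).

Definition homeo_mul (f g : homeo) : homeo :=
  Homeo (can_comp (homeo_funK f) (homeo_funK g))
    (can_comp (homeo_invK g) (homeo_invK f))
    (fun x => continuous_comp (@homeo_fun_continuous g x)
                (@homeo_fun_continuous f (g x)))
    (fun x => continuous_comp (@homeo_inv_continuous f x)
                (@homeo_inv_continuous g (homeo_inv f x))).

Lemma homeo_mulA : associative homeo_mul.
Proof. by move=> f g h; exact: homeoP. Qed.

Lemma homeo_mul1 : left_id homeo_one homeo_mul.
Proof. by move=> f; exact: homeoP. Qed.

Lemma homeo_mulr1 : right_id homeo_one homeo_mul.
Proof. by move=> f; exact: homeoP. Qed.

Lemma homeo_mulV : left_inverse homeo_one homeo_opp homeo_mul.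
Proof. by move=> f; apply: homeoP => x; exact: homeo_funK. Qed.

Lemma homeo_mulrV : right_inverse homeo_one homeo_opp homeo_mul.
Proof. by move=> f; apply: homeoP => x; exact: homeo_invK. Qed.

HB.instance Definition _ := isGroup.Build homeo
  homeo_mulA homeo_mul1 homeo_mulr1 homeo_mulV homeo_mulrV.

Definition homeo_to_uniform (f : homeo) : {uniform Omega -> Omega} := f.

HB.instance Definition _ :=
  Topological.copy homeo (initial_topology homeo_to_uniform).

(* [{ptws G -> homeo}] carries the product topology of [homeo ^ G], and the
   types [Xi G] and [Xi_min G] coerced from the sets below carry the subspace
   topologies. *)
Definition Xi (G : groupType) : set {ptws G -> homeo} :=
  [set xi | monoid_morphism (xi : G -> homeo)].
Arguments Xi : clear implicits.

Definition act (G : groupType) (xi : Xi G) (g : G) : homeo := set_val xi g.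

Definition minimal_action (G : groupType) (xi : Xi G) : Prop :=
  forall C : set Omega, closed C -> (forall g, act xi g @` C `<=` C) ->
    C = set0 \/ C = setT.

Definition Xi_min (G : groupType) : set (Xi G) :=
  [set xi | minimal_action xi].
Arguments Xi_min : clear implicits.

Record nondegenerate_partition : Type := NondegeneratePartition {
  blocks :> set (set Omega);
  blocks_finite : finite_set blocks;
  blocks_partition : partition blocks id setT;
  blocks_clopen : forall a, blocks a -> clopen a }.

(* Rauzy graph with vertex set [V]. *)
Record rauzy_graph (G : groupType) (S0 : set G) (V : Type) : Type :=
  RauzyGraph {
    edge : Type;
    esource : edge -> V;
    erange : edge -> V;
    elabel : edge -> G;
    ebar : edge -> edge;
    elabel_gen : forall e, sym_gens S0 (elabel e);
    ebarK : involutive ebar;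
    esource_bar : forall e, esource (ebar e) = erange e;
    erange_bar : forall e, erange (ebar e) = esource e;
    elabel_bar : forall e, elabel (ebar e) = (elabel e)^-1;
    edge_inj : injective (fun e => (esource e, erange e, elabel e));
    edge_ex : forall v s, sym_gens S0 s ->
      exists e, esource e = v /\ elabel e = s }.

Section RauzyGraph.
Context (G : groupType) (S0 : set G) (V : Type).
Implicit Type Gr : rauzy_graph S0 V.

Definition arrow Gr (v1 : V) (s : G) (v2 : V) : Prop :=
  exists e : edge Gr, [/\ esource e = v1, erange e = v2 & elabel e = s].

(* Equality of Rauzy graphs on the same vertices: edges are identified with
   their triples (source, range, label). *)
Definition same_rauzy_graph Gr1 Gr2 : Prop :=
  forall v1 s v2, arrow Gr1 v1 s v2 <-> arrow Gr2 v1 s v2.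

Definition reduced_step Gr (e f : edge Gr) : bool :=
  `[< erange e = esource f /\ elabel e <> (elabel f)^-1 >].

(* [e :: p] is a reduced path. *)
Definition reduced_path Gr (e : edge Gr) (p : seq (edge Gr)) : bool :=
  path (@reduced_step Gr) e p.

Definition minimal_rauzy_graph Gr : Prop :=
  forall e f : edge Gr, exists p : seq (edge Gr),
    reduced_path e p /\ (last e p = f \/ last e p = ebar f).

End RauzyGraph.

Section RauzyGraphOfAction.
Context (G : groupType) (S0 : set G) (xi : Xi G) (A : nondegenerate_partition).

Definition meets (a : A) (s : G) (b : A) : Prop :=
  (set_val a `&` act xi s @` set_val b) !=set0.

Definition action_edge : Type :=
  {t : A * A * G | sym_gens S0 t.2 /\ meets t.1.1 t.2 t.1.2}.

Lemma act1 : act xi 1 = 1.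
Proof. by case: (set_valP xi) => xi1 _. Qed.

Lemma actM g h : act xi (g * h) = act xi g * act xi h.
Proof. by case: (set_valP xi) => _ xiM; exact: xiM. Qed.

Lemma actK g : cancel (act xi g) (act xi g^-1).
Proof.
move=> x; have := actM g^-1 g; rewrite mulVg act1.
by move=> /(congr1 (fun f : homeo => f x)).
Qed.

Lemma actVK g : cancel (act xi g^-1) (act xi g).
Proof. by move=> x; have := actK g^-1 x; rewrite invgK. Qed.

Lemma sym_gensV s : sym_gens S0 s -> sym_gens S0 s^-1.
Proof.
by case=> [S0s|[t S0t <-]]; [right; exists s | left; rewrite invgK].
Qed.

Lemma meetsV a s b : meets a s b -> meets b s^-1 a.
Proof.
move=> [x [ax [y b_y yx]]]; exists y; split=> //.
by exists x => //; rewrite -yx actK.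
Qed.

Definition action_bar (e : action_edge) : action_edge :=
  let: exist (a, b, s) (conj Ss abs) := e in
  exist _ (b, a, s^-1) (conj (sym_gensV Ss) (meetsV abs)).

Lemma action_edge_inj : injective (fun e : action_edge =>
  ((sval e).1.1, (sval e).1.2, (sval e).2)).
Proof.
move=> [[[a b] s] p] [[[a' b'] s'] p'] /= [aa' bb' ss'].
by subst a' b' s'; rewrite (Prop_irrelevance p p').
Qed.

Lemma action_barK : involutive action_bar.
Proof.
by move=> [[[a b] s] [? ?]]; apply: action_edge_inj; rewrite /= invgK.
Qed.

Lemma action_edge_ex (v : A) s : sym_gens S0 s ->
  exists e : action_edge, (sval e).1.1 = v /\ (sval e).2 = s.
Proof.
move=> Ss; have [Acov _ An0] := blocks_partition A.
have [x vx] : set_val v !=set0 := An0 _ (set_valP v).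
have [b Ab bx] : cover A id (act xi s^-1 x) by rewrite Acov.
have vsb : meets v s (SigSub (mem_set Ab)).
  by exists x; split=> //; exists (act xi s^-1 x) => //; exact: actVK.
by exists (exist _ (v, SigSub (mem_set Ab), s) (conj Ss vsb)).
Qed.

Definition rauzy_graph_of_action : rauzy_graph S0 A.
Proof.
refine (@RauzyGraph _ _ _ action_edge
  (fun e => (sval e).1.1) (fun e => (sval e).1.2) (fun e => (sval e).2)
  action_bar _ action_barK _ _ _ action_edge_inj action_edge_ex).
- by move=> [t []].
- by move=> [[[a b] s] []].
- by move=> [[[a b] s] []].
- by move=> [[[a b] s] []].
Defined.

Lemma arrow_rauzy_graph_of_action a s b :
  arrow rauzy_graph_of_action a s b <-> sym_gens S0 s /\ meets a s b.
Proof.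
split=> [[[[[a' b'] s'] [? ?]] [/= <- <- <-]]//|Ssab].
by exists (exist _ (a, b, s) Ssab).
Qed.

End RauzyGraphOfAction.

Section Neighborhoods.
Context (G : groupType) (S0 : set G) (A : nondegenerate_partition).
Context (Gr : rauzy_graph S0 A).

Definition Nset : set (Xi G) :=
  [set xi | same_rauzy_graph (rauzy_graph_of_action S0 xi A) Gr].

(* [N(Gr)] intersected with [Xi_min G], as a subset of the space [Xi_min G]. *)
Definition Nmin : set (Xi_min G) := set_val @^-1` Nset.

End Neighborhoods.

(* Main.v *)
Require Import Defs.
From HB Require Import structures.
From mathcomp Require Import all_boot.
From mathcomp Require Import mathcomp_extra boolp classical_sets functions.
From mathcomp Require Import cardinality.
From mathcomp Require Import topology cantor.

(** Write a point of an action as a vertex of its Schreier graph. Along the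
reduced word [s_1 ... s_n] the point [x] moves to [s_1^-1 x], then to
[s_2^-1 s_1^-1 x], and so on; recording the blocks that it visits gives a
reduced path in the Rauzy graph of the action, since [a --s--> b] says that
some point of [a] is moved into [b] by [s^-1].

Non-emptiness. Let [Gr] be a minimal Rauzy graph on [A]. By minimality every
edge begins a reduced path, its tour, that runs through all edges of [Gr] up to
reversal ([tour_exists]). Colour the Cayley tree of [G] by vertices of [Gr],
outwards from [1]: follow the current tour where it tells which edge to take,
choose any edge elsewhere, and start a new tour as soon as the old one is
finished or abandoned. Colours of neighbours are then joined by arrows of [Gr],
and every ball of a fixed radius in the tree contains every edge of [Gr]
([recurrent_colouring]). Both properties are closed and shift-invariant, so
they hold throughout the compact space of all such colourings of [G]. To each
group element one adds counters in [Z/1, Z/2, Z/3, ...], raised by one by each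
generator; they rule out periodic points. Zorn's lemma gives a minimal
subsystem [M] of this space ([minimal_subsystem]). All edges of [Gr] occur in
[M], so its partition by the colour at [1] has exactly the Rauzy graph [Gr];
and [M] has no isolated point, since by minimality such a point would be fixed
by some power of a generator ([M_perfect]). Hence every colour class of [M],
like every block of [A], is a Cantor space ([cantor_chart]). Matching class by
class gives a homeomorphism of [Omega] onto [M] that carries blocks to colours
([omega_model]), and the shift on [M] becomes the required action.

Basis. The graph on [A] only depends on the generators up to a small uniform
error, so the sets [Nmin Gr] are open ([Nmin_open]). Conversely the graphs of a
minimal action on the partitions into cylinders of length [n] determine the
generators, hence the whole action, up to an error tending to [0]
([graph_filter_cvg]). These graphs are minimal: for an edge [e] seen at [x] and
an edge [f], walk far away from [x] through [e]; by minimality of the action a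
bounded further walk reaches a point where [f] is seen, and it is too short to
cancel the first step. The reduced form of the whole walk is a reduced path
from [e] to [f] or its reverse ([graph_of_minimal_action]). *)

Set Implicit Arguments.
Unset Strict Implicit.
Unset Printing Implicit Defensive.

Local Open Scope classical_set_scope.
Local Open Scope group_scope.

(** * Free generation *)

Record bij (Z : Type) : Type := Bij {
  bij_fun :> Z -> Z;
  bij_inv : Z -> Z;
  bij_funK : cancel bij_fun bij_inv;
  bij_invK : cancel bij_inv bij_fun }.

Section BijGroup.
Variable Z : Type.
Implicit Types f g h : bij Z.

Lemma bijP f g : bij_fun f =1 bij_fun g -> f = g.
Proof.
case: f g => [f fi fK fiK] [g gi gK giK] /= /funext fg; subst g.
have gifi : gi = fi by apply/funext => x; rewrite -{1}(fiK x) gK.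
by subst gi; congr Bij; exact: Prop_irrelevance.
Qed.

HB.instance Definition _ := gen_eqMixin (bij Z).
HB.instance Definition _ := gen_choiceMixin (bij Z).

Definition bij_one : bij Z := @Bij Z idfun idfun (fun=> erefl) (fun=> erefl).
Definition bij_opp f : bij Z := Bij (bij_invK f) (bij_funK f).
Definition bij_mul f g : bij Z :=
  Bij (can_comp (bij_funK f) (bij_funK g)) (can_comp (bij_invK g) (bij_invK f)).

Fact bij_mulA : associative bij_mul. Proof. by move=> f g h; exact: bijP. Qed.
Fact bij_mul1 : left_id bij_one bij_mul. Proof. by move=> f; exact: bijP. Qed.
Fact bij_mulr1 : right_id bij_one bij_mul.
Proof. by move=> f; exact: bijP. Qed.
Fact bij_mulV : left_inverse bij_one bij_opp bij_mul.
Proof. by move=> f; apply: bijP => x; exact: bij_funK. Qed.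
Fact bij_mulrV : right_inverse bij_one bij_opp bij_mul.
Proof. by move=> f; apply: bijP => x; exact: bij_invK. Qed.

HB.instance Definition _ := isGroup.Build (bij Z)
  bij_mulA bij_mul1 bij_mulr1 bij_mulV bij_mulrV.

End BijGroup.

Section FreeGroup.
Variables (G : groupType) (S0 : set G).
Hypothesis G_free : freely_generated_by S0.

(** The universal property of [G] tested on the group of bijections of [Z]: to
define a function on [G] by recursion along generators it suffices that each
recursion step is invertible. *)
Lemma free_rec (Z : Type) (f f' : G -> Z -> Z) (z0 : Z) :
  (forall s, S0 s -> cancel (f s) (f' s) /\ cancel (f' s) (f s)) ->
  exists nf : G -> Z,
    nf 1 = z0 /\ forall s g, S0 s -> nf (s * g) = f s (nf g).
Proof.
move=> ff'.
have fK (s : S0) : cancel (f (set_val s)) (f' (set_val s)).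
  by case: (ff' _ (set_valP s)).
have f'K (s : S0) : cancel (f' (set_val s)) (f (set_val s)).
  by case: (ff' _ (set_valP s)).
have [phi [[[phi1 phiM] phis] _]] := G_free (fun s => Bij (fK s) (f'K s)).
exists (fun g => phi g z0); split=> [|s g S0s]; first by rewrite phi1.
rewrite phiM /=.
have := phis (SigSub (mem_set S0s)).
by move/(congr1 (fun b : bij Z => b (phi g z0))).
Qed.

(** Two actions of [G] on [G * bool] are compared: left translation, and its
conjugate by the involution exchanging the two sheets over [P]. They agree on
the generators, hence everywhere by the uniqueness of the universal property,
so [g] lies in [P] along with [1]. *)
Lemma gen_ind (P : G -> Prop) :
  P 1 -> (forall s g, S0 s -> P g <-> P (s * g)) -> forall g, P g.
Proof.
move=> P1 PS g.
pose mul h (x : G * bool) := (h * x.1, x.2).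
have mulK h : cancel (mul h) (mul h^-1) by case=> x b; rewrite /mul /= mulKg.
have mulVK h : cancel (mul h^-1) (mul h) by case=> x b; rewrite /mul /= mulVKg.
pose lam h := Bij (mulK h) (mulVK h).
pose sw (x : G * bool) := (x.1, x.2 (+) `[< P x.1 >]).
have swK : cancel sw sw by case=> x b; rewrite /sw /= addbK.
pose tau := Bij swK swK.
pose lam' h : bij (G * bool)%type := tau * lam h * tau.
have lamM h k : lam (h * k) = lam h * lam k.
  by apply: bijP => -[x b]; rewrite /= /mul /= mulgA.
have lam1 : lam 1 = 1 by apply: bijP => -[x b]; rewrite /= /mul /= mul1g.
have tautau : tau * tau = 1 by apply: bijP => x; exact: swK.
have [phi [_ phiU]] := G_free (fun s : S0 => lam (set_val s)).
have phil : phi = lam by apply: phiU.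
have phil' : phi = lam'.
  apply: phiU; split; first split; rewrite /lam'.
  - by rewrite lam1 mulg1.
  - by move=> h k; rewrite lamM !mulgA -(mulgA (tau * lam h) tau) tautau mulg1.
  - move=> s; apply: bijP => -[x b] /=; rewrite /sw /mul /=.
    (* both sheets over [x] are exchanged exactly when those over [s x] are *)
    congr pair.
    have /asbool_equiv_eq <- := PS _ x (set_valP s).
    by rewrite -addbA addbb addbF.
have : lam g = lam' g by rewrite -[LHS](congr1 (@^~ g) phil) phil'.
move=> /(congr1 (fun t : bij _ => bij_fun t (1, false))) /=.
rewrite /sw /mul /= mulg1 (asboolT P1) => -[].
by case: asboolP.
Qed.

Lemma gen_indV (P : G -> Prop) : P 1 ->
  (forall s g, sym_gens S0 s -> P g -> P (s * g)) -> forall g, P g.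
Proof.
move=> P1 PS; apply: gen_ind => // s g S0s; split=> [|Psg].
  by apply: PS; left.
rewrite -(mulKg s g); apply: PS => //; right; exists s => //.
Qed.

(** The homomorphism from [G] to the integers that sends generators to one,
taken modulo [k.+1]; it tells apart the powers of a generator. *)
Lemma counter_exists (k : nat) : exists u : G -> 'I_k.+1,
  forall s g, S0 s -> u (s * g) = ordS (u g).
Proof.
have [s _|u [_ uS]] :=
  @free_rec 'I_k.+1 (fun=> @ordS _) (fun=> @ord_pred _) ord0.
  by split; [exact: ordSK | exact: ord_predK].
by exists u.
Qed.

Lemma gen_neqV s : sym_gens S0 s -> s <> s^-1.
Proof.
suff H t : S0 t -> t <> t^-1.
  by case=> [/H//|[t /H tt' <-]] /eqP; rewrite invgK eq_sym => /eqP.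
move=> S0t tt'; have [u uS] := counter_exists 2.
have : u (t * (t * 1)) = u 1 by rewrite mulgA {2}tt' mulgV mul1g.
rewrite !uS // => /(congr1 val) /=.
by case: (u 1) => [[|[|[|]]]].
Qed.

End FreeGroup.

(** * Cantor charts *)

Lemma compact_set_type (X : topologicalType) (K : set X) :
  compact K -> compact [set: K].
Proof.
move=> K_compact F FF _; have FK : (set_val @ F) K.
  by apply: (@filterS _ F _ setT) filterT => x _; exact: set_valP.
have [x [Kx clx]] := K_compact _ (fmap_proper_filter _ _) FK.
exists (SigSub (mem_set Kx)); split=> // A B FA [_ [[W oW <-] /= Wx WB]].
have /clx /(_ _) : (set_val @ F) (set_val @` A).
  by apply: (@filterS _ F _ A) FA => y Ay; exists y.
move=> /(_ W (open_nbhs_nbhs _)) [|_ [[y Ay <-] Wy]]; first by split.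
by exists y; split=> //; exact: WB.
Qed.

Section Chart.
Variables (X : topologicalType) (K : set X) (U : nat -> set X).
Hypothesis K_compact : compact K.
Hypothesis K_neq0 : K !=set0.
Hypothesis U_clopen : forall n, clopen (U n).
Hypothesis U_sep : forall x y, K x -> K y -> x <> y ->
  exists n, ~ (U n x <-> U n y).
Hypothesis K_perfect : forall V x, open V -> K x -> V x ->
  exists y, [/\ K y, V y & y <> x].

Let V n : set K := set_val @^-1` U n.

Let V_clopen n : clopen (V n).
Proof.
by apply: preimage_clopen => //; exact: initial_continuous.
Qed.

Let V_sep (x y : K) : x != y -> exists n, ~ (V n x <-> V n y).
Proof.
move=> /eqP xy; apply: U_sep; [exact: set_valP..|] => exy.
exact/xy/val_inj.
Qed.

Let split_clopen (A : set K) : exists n, 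
  open A -> A !=set0 -> V n `&` A !=set0 /\ ~` V n `&` A !=set0.
Proof.
have [oA|?] := pselect (open A); last by exists 0.
have [[x Ax]|?] := pselect (A !=set0); last by exists 0.
have [W oW WA] := oA; have Wx : W (set_val x) by rewrite -WA in Ax.
have [z [Kz Wz zx]] := K_perfect oW (set_valP x) Wx.
pose y : K := SigSub (mem_set Kz).
have Ay : A y by rewrite -WA.
have /V_sep[n nxy] : x != y.
  by apply/eqP => xy; apply: zx; rewrite xy.
exists n => _ _; have [Vx|nVx] := pselect (V n x).
  split; first by exists x.
  by exists y; split=> // Vy; apply: nxy.
split; last by exists x.
exists y; split=> //; apply: contrapT => nVy; apply: nxy; split=> //.
Qed.

Let ind n (A : set K) (b : bool) : set K :=
  let W := if pselect (V n `&` A !=set0 /\ ~` V n `&` A !=set0)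
    then V n else V (projT1 (cid (split_clopen A))) in
  (if b then W else ~` W) `&` A.

(** Split [K] again and again, at step [n] along [U n], or along some [U m] that
does split the piece at hand if [U n] does not. Pieces never become empty or
stop splitting, and in the end they separate points, so [K] is the space of
branches of a binary tree. *)
Lemma cantor_chart : exists p : Omega -> X,
  [/\ continuous p, injective p & range p = K].
Proof.
have [x0 Kx0] := K_neq0.
pose pK := isPointed.Build K (SigSub (mem_set Kx0)).
pose T : ptopologicalType := HB.pack_for ptopologicalType (set_type K) pK.
have hT : hausdorff_space T.
  move=> x y clxy; apply: contrapT => /eqP /V_sep [n]; apply.
  have sep z t : cluster (nbhs (z : T)) t -> V n z -> V n t.
    move=> clzt Vz; apply: contrapT => nVt.
    have [oV cV] := V_clopen n.
    have := clzt (V n) (~` V n) (open_nbhs_nbhs (conj oV Vz))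
      (open_nbhs_nbhs (conj (closed_openC cV) nVt)).
    by case=> u [].
  split; apply: sep => //.
  by move=> A B nA nB; rewrite setIC; exact: clxy.
have [] := @tree_map_props (fun=> bool) T ind
  (fun A => clopen A /\ A !=set0) (compact_set_type K_compact) hT.
- move=> n A; rewrite eqEsubset; split=> [t At|t [? _ []]//].
  rewrite /ind; set W := (if _ then _ else _).
  by have [Wt|Wt] := pselect (W t); [exists true|exists false].
- move=> n A b [cA A0]; rewrite /ind; case: pselect => /=.
    move=> [h1 h2]; case: b => //; split=> //; apply: clopenI => //.
    exact: clopenC.
  move=> _; case: cid => m /= /(_ cA.1 A0) [h1 h2].
  case: b; split=> //; apply: clopenI => //.
  exact: clopenC.
- by move=> ? [].
- by split; [exact: clopenT | exists point].
- by move=> ? [[]].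
- move=> x y /V_sep [n nxy]; exists n => A b.
  rewrite /ind; case: pselect => /=.
    by move=> _; case: b => -[/= Vx Ax] [Vy Ay]; apply: nxy.
  move=> nsplit [_ Ax] [_ Ay]; apply: nsplit.
  have [Vx|nVx] := pselect (V n x).
    split; first by exists x.
    by exists y; split=> // Vy; apply: nxy.
  split; last by exists x.
  by exists y; split=> //; apply: contrapT => nVy; apply: nxy; split.
- move=> f [cf sf injf]; exists (set_val \o f); split.
  + move=> x; apply: continuous_comp; first exact: cf.
    exact: initial_continuous.
  + move=> x y /val_inj; apply: injf; rewrite ?inE//.
    by move=> n A i j _ _ [z] [] [] + _ [+ _]; case: i; case: j.
  + rewrite eqEsubset; split=> [_ [x _ <-]|x Kx]; first exact: set_valP.
    by have [y _ fy] := sf (SigSub (mem_set Kx)) I; exists y => //=; rewrite fy.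
Qed.

End Chart.

Lemma cantor_coord_clopen n (b : bool) : clopen [set x : Omega | x n = b].
Proof.
have -> : [set x : Omega | x n = b] = proj n @^-1` [set b] by [].
apply: preimage_clopen; last exact: (@proj_continuous nat (fun=> bool) n).
by split; [exact: discrete_open|exact: discrete_closed].
Qed.

Lemma cantor_image_closed (p : Omega -> Omega) (C : set Omega) :
  continuous p -> closed C -> closed (p @` C).
Proof.
move=> cp cC; apply: compact_closed; first exact: cantor_space_hausdorff.
apply: continuous_compact; first exact: continuous_subspaceT.
exact: (subclosed_compact cC cantor_space_compact).
Qed.

Lemma clopen_chart (a : set Omega) : clopen a -> a !=set0 ->
  exists p : Omega -> Omega, [/\ continuous p, injective p & range p = a].
Proof.
move=> [oa ca] a0.
apply: (@cantor_chart _ _ (fun n => [set x : Omega | x n = true])) => //.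
- exact: (subclosed_compact ca cantor_space_compact).
- by move=> n; exact: cantor_coord_clopen.
- move=> x y _ _ xy; apply: contrapT => /forallNP H; apply: xy.
  apply/funext => n; have /contrapT /= := H n.
  by case: (x n) (y n) => [] [] // [h1 h2]; [rewrite h1|rewrite h2].
- move=> V x oV ax Vx.
  have := iffLR perfectTP cantor_perfect x.
  have [//|nsub] := pselect (exists y, [/\ a y, V y & y <> x]).
  case; have -> : [set x] = a `&` V; last exact: openI.
  rewrite eqEsubset; split=> [_ -> //|y [ay Vy]] /=.
  by apply: contrapT => yx; apply: nsub; exists y.
Qed.

Section Glue.
Variables (X : topologicalType) (A : nondegenerate_partition).
Variables (M : set Omega -> set X).
Hypothesis M_triv : trivIset (blocks A) M.
Hypothesis M_chart : forall a, blocks A a ->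
  exists p : Omega -> X, [/\ continuous p, injective p & range p = M a].

(** Both the blocks of [A] and the sets [M a] are copies of [Omega]; matching
them one by one identifies [Omega] with the union of the [M a]. The map is
continuous because the preimage of a closed set is a finite union of images of
compact sets. *)
Lemma glue_charts : exists Phi : Omega -> X,
  [/\ continuous Phi, injective Phi & forall a, blocks A a -> Phi @` a = M a].
Proof.
have /choice[p pP] (a : A) : exists p : Omega -> X,
  [/\ continuous p, injective p & range p = M (set_val a)].
  exact: M_chart (set_valP a).
have /choice[q qP] (a : A) : exists q : Omega -> Omega,
  [/\ continuous q, injective q & range q = set_val a].
  apply: clopen_chart; first by apply: (@blocks_clopen A); exact: set_valP.
  by case: (blocks_partition A) => _ _; apply; exact: set_valP.
have qA (a : A) w : set_val a (q a w) by have [_ _ <-] := qP a; exists w.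
have pM (a : A) w : M (set_val a) (p a w) by have [_ _ <-] := pP a; exists w.
have [Acov Atriv _] := blocks_partition A.
have /choice[Phi PhiP] (y : Omega) : exists x, exists (a : A) w,
    q a w = y /\ p a w = x.
  have [b Ab b_y] : cover (blocks A) id y by rewrite Acov.
  pose a : A := SigSub (mem_set Ab).
  have [_ _ ra] := qP a.
  have [w _ qw] : range (q a) y by rewrite ra.
  by exists (p a w), a, w.
have Phiq a w : Phi (q a w) = p a w.
  have [b [v [qvw <-]]] := PhiP (q a w).
  have ba : b = a.
    apply/val_inj/Atriv; [exact: set_valP..|].
    by exists (q a w); split; [rewrite -qvw; exact: qA|exact: qA].
  rewrite ba in qvw *; congr (p a _).
  by have [_ qi _] := qP a; apply: qi.
have PhiM (a : A) : Phi @` (set_val a) = M (set_val a).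
  have [_ _ <-] := pP a; have [_ _ <-] := qP a.
  rewrite eqEsubset; split=> [_ [_ [w _ <-] <-]|_ [w _ <-]].
    by exists w => //; rewrite Phiq.
  by exists (q a w) => //; exists w.
exists Phi; split.
- apply/continuousP => D oD; rewrite -[Phi @^-1` D]setCK.
  apply: closed_openC; rewrite preimage_setC.
  have -> : Phi @^-1` (~` D) =
      \bigcup_(a in [set: A]) (q a @` (p a @^-1` (~` D))).
    rewrite eqEsubset; split=> [y /= Dy|_ [a _ [w Dw <-]]].
      have [a [w [qw pw]]] := PhiP y.
      by exists a => //; exists w => //=; rewrite pw.
    by rewrite /= Phiq.
  apply: closed_bigcup.
  + by rewrite (eq_finite_set (card_setT _)); exact: blocks_finite.
  + move=> a _; have [cq _ _] := qP a; have [cp _ _] := pP a.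
    apply: cantor_image_closed => //.
    apply: closed_comp; last exact: open_closedC.
    by move=> w _; exact: cp.
- move=> y z yz; have [a [w [qw pw]]] := PhiP y.
  have [b [v [qv pv]]] := PhiP z.
  have ab : a = b.
    apply/val_inj/M_triv; [exact: set_valP..|].
    exists (Phi y); split; first by rewrite -pw; exact: pM.
    by rewrite yz -pv; exact: pM.
  rewrite -qw -qv -ab; congr (q a _); have [_ pi _] := pP a; apply: pi.
  by rewrite pw yz -pv ab.
- by move=> a Aa; rewrite (PhiM (SigSub (mem_set Aa))).
Qed.

End Glue.

(** * Minimal subsystems *)

Section MinimalSubsystem.
Variables (X : topologicalType) (I : Type) (T : I -> X -> X).

Definition invariant_set (C : set X) := forall i x, C x -> C (T i x).

(** Zorn's lemma is applied to the open sets whose complement in [Y] is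
invariant and non-empty; compactness bounds their chains. *)
Lemma minimal_subsystem (Y : set X) :
  compact Y -> closed Y -> Y !=set0 -> invariant_set Y ->
  exists M, [/\ M `<=` Y, closed M, M !=set0, invariant_set M &
    forall C, C `<=` M -> closed C -> C !=set0 -> invariant_set C -> M `<=` C].
Proof.
move=> cY clY Y0 iY.
pose P (B : set X) := [/\ open B, Y `\` B !=set0 & invariant_set (Y `\` B)].
have [|B [[oB YB0 iB] Bmax]] := @Zorn_bigcup X P.
  move=> F FP Fchain; split.
  - by apply: bigcup_open => B /FP [].
  - have [[B0 FB0]|F0] := pselect (F !=set0); last first.
      have [y Yy] := Y0; exists y; split=> // -[B FB _]; apply: F0.
      by exists B.
    pose FF := filter_from F (fun B => Y `\` B).
    (* the sets [Y `\` B] for [B] in the chain generate a filter, and a cluster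
       point of it avoids every [B] *)
    have FFf : Filter FF.
      apply: filter_from_filter; first by exists B0.
      move=> B C FB FC; have [BC|CB] := Fchain _ _ FB FC.
        by exists C => // x [Yx nCx]; split; split=> // /BC.
      by exists B => // x [Yx nCx]; split; split=> // /CB.
    have FFp : ProperFilter FF.
      by apply: filter_from_proper => B /FP [].
    have FFY : FF Y by exists B0 => // ? [].
    have [x [Yx]] := cY _ FFp FFY.
    rewrite clusterE => clx; exists x; split=> // -[B FB Bx].
    have [oB _ _] := FP _ FB.
    have : closure (Y `\` B) x by apply: clx; exists B.
    move=> /(_ _ (open_nbhs_nbhs (conj oB Bx))) [y [[_ nBy] By]].
    exact: nBy.
  - move=> i x [Yx nx]; split; first exact: iY.
    move=> [B FB BTx]; have [_ _ iB] := FP _ FB.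
    have [] // := iB i x.
    by split=> // Bx; apply: nx; exists B.
exists (Y `\` B); split=> //.
  by rewrite setDE; apply: closedI => //; exact: open_closedC.
move=> C CM clC C0 iC x Mx; apply: contrapT => nCx.
apply: (Bmax (B `|` ~` C)).
  split; first by move=> y; left.
  by move=> /(_ x) h; case: Mx => _; apply; apply: h; right.
have YBC : Y `\` (B `|` ~` C) = C.
  rewrite eqEsubset; split=> [y [Yy /not_orP[_ /contrapT]] //|y Cy].
  by have [Yy nBy] := CM _ Cy; split=> // -[].
by split; rewrite ?YBC //; apply: openU => //; exact: closed_openC.
Qed.

End MinimalSubsystem.

Section OrbitDense.
Variables (X : topologicalType) (G : groupType) (T : G -> X -> X) (M : set X).
Hypothesis T_cont : forall g, continuous (T g).
Hypothesis TM : forall g h x, T (g * h) x = T g (T h x).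
Hypothesis M_closed : closed M.
Hypothesis M_inv : invariant_set T M.
Hypothesis M_min : forall C, C `<=` M -> closed C -> C !=set0 ->
  invariant_set T C -> M `<=` C.

(** The closure of an orbit in [M] is closed and invariant, hence is [M]. *)
Lemma minimal_orbit_meets (V : set X) x q :
  open V -> M x -> V x -> M q -> exists g, V (T g q).
Proof.
move=> oV Mx Vx Mq; pose O := range (T ^~ q).
suff Ox : closure O x.
  by have [_ [[g _ <-] Vg]] := Ox V (open_nbhs_nbhs (conj oV Vx)); exists g.
apply: M_min => //.
- move=> y; rewrite (closure_id M).1 //; apply: closure_subset.
  by move=> _ [g _ <-]; exact: M_inv.
- exact: closed_closure.
- by exists (T 1 q); apply: subset_closure; exists 1.
- move=> h y Oy W /(T_cont (x := y)) /Oy [_ [[g _ <-] Wg]].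
  by exists (T h (T g q)); split=> //; exists (h * g).
Qed.

(** A sequence in [M] has a cluster point [q], and some translate [T g q] lies
in [V]; by continuity so does [T g (z m)] for infinitely many [m]. *)
Lemma orbit_cluster (z : nat -> X) (V : set X) x :
  compact M -> open V -> M x -> V x -> (forall n, M (z n)) ->
  exists g, forall n, exists2 m, n <= m & V (T g (z m)).
Proof.
move=> cM oV Mx Vx Mz.
have [q [Mq clq]] : M `&` cluster (z @ \oo) !=set0.
  by apply: cM; exists 0 => // n _; exact: Mz.
have [g Vg] := minimal_orbit_meets oV Mx Vx Mq.
exists g => n.
have /clq : (z @ \oo) [set z m | m in [set m | n <= m]].
  by exists n => // m /= nm; exists m.
have nV : nbhs q (T g @^-1` V) by apply: T_cont; apply: open_nbhs_nbhs.
by move=> /(_ _ nV) [_ [[m nm <-] Vm]]; exists m.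
Qed.

End OrbitDense.

(** * Recurrent colourings of the Cayley tree *)

Section ReducedWords.
Variables (G : groupType) (S0 : set G).
Hypothesis G_free : freely_generated_by S0.
Implicit Types (s t : G) (w : seq G).

(** A word is the stack of the letters of a reduced path, the last letter on
top. A fresh letter prolongs the path; pushing any other one takes back the
last step. *)
Definition fresh s w := if w is t :: _ then t != s^-1 else true.

Definition push s w :=
  if w is t :: w' then if t == s^-1 then w' else s :: w else [:: s].

Fixpoint reduced_word w :=
  if w is s :: w' then [&& `[< sym_gens S0 s >], fresh s w' & reduced_word w']
  else true.

Lemma push_fresh s w : fresh s w -> push s w = s :: w.
Proof. by case: w => //= t w /negPf ->. Qed.

Lemma push_reduced s w :
  sym_gens S0 s -> reduced_word w -> reduced_word (push s w).
Proof.
move=> Ss; case: w => [|t w] /=; first by rewrite asboolT.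
case: eqP => [_ /and3P[]//|/eqP ts /and3P[St tw rw]] /=.
by rewrite asboolT // ts St tw.
Qed.

Lemma pushK s w : reduced_word w -> push s^-1 (push s w) = w.
Proof.
case: w => [_|t w] /=; first by rewrite invgK eqxx.
case: eqP => [-> /and3P[_ fw _]|_ _]; last by rewrite /= invgK eqxx.
by rewrite push_fresh.
Qed.

(** On reduced words pushing [s] and pushing [s^-1] are inverse to each other,
so [G] acts on them; the normal form of [g] is the image of the empty word. *)
Lemma normal_form : exists nf : G -> seq G,
  [/\ nf 1 = [::], forall g, reduced_word (nf g) &
    forall s g, sym_gens S0 s -> nf (s^-1 * g) = push s (nf g)].
Proof.
pose Z := {w : seq G | reduced_word w}.
pose act s (z : Z) : Z := insubd z (push s (val z)).
have actE s z : sym_gens S0 s -> val (act s z) = push s (val z).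
  by move=> Ss; rewrite val_insubd push_reduced //; exact: valP.
have actK s : sym_gens S0 s -> cancel (act s) (act s^-1).
  move=> Ss z; apply: val_inj; rewrite !actE //; last exact: sym_gensV.
  by rewrite pushK //; exact: valP.
have actVK s : sym_gens S0 s -> cancel (act s^-1) (act s).
  by move=> Ss z; have := actK _ (sym_gensV Ss) z; rewrite invgK.
have [|nf [nf1 nfM]] := @free_rec _ _ G_free Z (fun s => act s^-1) act
    (exist (fun w => reduced_word w) [::] erefl).
  move=> s S0s; have Ss : sym_gens S0 s by left.
  by split; [exact: actVK|exact: actK].
exists (val \o nf); split=> [|g|s g].
- by rewrite /= nf1.
- exact: valP.
- move=> Ss; rewrite -actE //=; congr val.
  case: (Ss) => [S0s|[t S0t <-]]; last by rewrite invgK nfM.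
  by rewrite -[in RHS](mulVKg s g) nfM // actVK.
Qed.

End ReducedWords.

Notation pushes := (foldl (fun w s => push s w)).

Section Tours.
Variables (G : groupType) (S0 : set G) (V : eqType) (Gr : rauzy_graph S0 V).
Hypothesis Gr_minimal : minimal_rauzy_graph Gr.
Implicit Types (e f : edge Gr) (p : seq (edge Gr)).

Definition runs_through f p := has (fun x => `[< x = f \/ x = ebar f >]) p.

Lemma arrow_bar v s v' : arrow Gr v s v' -> arrow Gr v' s^-1 v.
Proof.
move=> [e [<- <- <-]]; exists (ebar e).
by rewrite esource_bar erange_bar elabel_bar.
Qed.

(** Prolong the path edge by edge, reaching the next prescribed edge up to
reversal by minimality of the graph. *)
Lemma tour_exists (vs : seq V) (ls : seq G) :
  (forall v, v \in vs) -> (forall s, sym_gens S0 s -> s \in ls) ->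
  forall e, exists p, reduced_path e p /\ forall f, runs_through f (e :: p).
Proof.
move=> vsP lsP e.
suff [p [ep pP]] : exists p, reduced_path e p /\ forall f,
    (esource f, erange f, elabel f) \in
      [seq (v, s) | v <- [seq (v, v') | v <- vs, v' <- vs], s <- ls] ->
    runs_through f (e :: p).
  exists p; split=> // f; apply: pP; apply: allpairs_f.
    exact: allpairs_f.
  exact/lsP/elabel_gen.
elim: {vsP lsP} [seq _ | _ <- _, _ <- _] => [|t ts [p [ep pP]]].
  by exists [::].
have [[f ft]|nt] := pselect (exists f, (esource f, erange f, elabel f) = t);
    last first.
  exists p; split=> // f; rewrite inE => /predU1P[ft|]; last exact: pP.
  by case: nt; exists f.
have [p' [pp' lp']] := Gr_minimal (last e p) f.
exists (p ++ p'); split=> [|f'].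
  by rewrite /reduced_path cat_path; exact/andP.
rewrite inE => /predU1P[f't|/pP]; last first.
  by rewrite /runs_through -cat_cons has_cat => ->.
have -> : f' = f by apply: edge_inj; rewrite ft.
by rewrite /runs_through lastI has_rcons last_cat asboolT.
Qed.

End Tours.

Section TreeColouring.
Variables (G : groupType) (S0 : set G) (V : eqType) (Gr : rauzy_graph S0 V).
Variables (vs : seq V) (ls : seq G) (e0 : edge Gr).
Variables (sel : V -> G -> edge Gr) (tour : edge Gr -> seq (edge Gr)).
Hypothesis G_free : freely_generated_by S0.
Hypothesis vsP : forall v, v \in vs.
Hypothesis lsP : forall s, sym_gens S0 s -> s \in ls.
Hypothesis selP : forall v s, sym_gens S0 s ->
  esource (sel v s) = v /\ elabel (sel v s) = s.
Hypothesis tourP : forall e, reduced_path e (tour e) /\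
  forall f, runs_through f (e :: tour e).
Implicit Types (e f : edge Gr) (p : seq (edge Gr)) (w : seq G).

Definition start v s := (sel v s, tour (sel v s)).

(** A state is the last edge taken, with the rest of the tour to be followed.
Moving along [s] takes the next edge of the tour if it has label [s], and
otherwise the selected edge with label [s], where a new tour starts. *)
Definition next_state (x : edge Gr * seq (edge Gr)) s :=
  if x.2 is f :: p then if elabel f == s then (f, p) else start (erange x.1) s
  else start (erange x.1) s.

Fixpoint state w :=
  if w is s :: w' then next_state (state w') s else (e0, [::]).

Definition colour w := erange (state w).1.

Lemma state_path w : reduced_path (state w).1 (state w).2.
Proof.
elim: w => //= s w; rewrite /next_state; case: (state w) => e [|f p] /=.
  by case: (tourP (sel (erange e) s)).
rewrite /reduced_path /= => /andP[_ fp]; case: ifP => _ //=.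
by case: (tourP (sel (erange e) s)).
Qed.

Lemma state_top s w : sym_gens S0 s -> elabel (state (s :: w)).1 = s.
Proof.
move=> Ss /=; rewrite /next_state; case: (state w) => e [|f p] /=.
  by case: (selP (erange e) Ss).
by case: eqP => //= _; case: (selP (erange e) Ss).
Qed.

(** Together with [state_top]: neighbours in the tree are joined by an arrow. *)
Lemma state_source s w : sym_gens S0 s ->
  esource (state (s :: w)).1 = colour w.
Proof.
move=> Ss; have := state_path w; rewrite /colour /= /next_state.
case: (state w) => e [|f p] /=; first by case: (selP (erange e) Ss).
case: eqP => /= _; last by case: (selP (erange e) Ss).
by case/andP => /asboolP[].
Qed.

Definition tour_bound := \max_(v <- vs) \max_(s <- ls) size (tour (sel v s)).

Lemma tour_boundP v s : sym_gens S0 s -> size (tour (sel v s)) <= tour_bound.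
Proof.
move=> Ss; apply: leq_trans (leq_bigmax_seq _ (vsP v) isT).
exact: (@leq_bigmax_seq _ ls xpredT _ s (lsP Ss) isT).
Qed.

Lemma size_state w : reduced_word S0 w -> size (state w).2 <= tour_bound.
Proof.
elim: w => [//|s w IH] /= /and3P[/asboolP Ss _ /IH]; rewrite /next_state.
case: (state w) => e [|f p] /= h; first exact: tour_boundP.
by case: eqP => _ /=; [exact: ltnW|exact: tour_boundP].
Qed.

(** A tour is a reduced path, so its next step never goes back. *)
Lemma state_fresh w f p : reduced_word S0 w -> (state w).2 = f :: p ->
  fresh (elabel f) w.
Proof.
case: w => //= s w /and3P[/asboolP Ss _ _] sw; apply/eqP => sf.
have := state_path (s :: w); rewrite /= sw /= => /andP[/asboolP[_ + _]]; apply.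
by have := state_top w Ss; rewrite /= -sf.
Qed.

Definition labels p := [seq elabel f | f <- p].

Lemma follow w p1 p2 : reduced_word S0 w -> (state w).2 = p1 ++ p2 ->
  [/\ pushes w (labels p1) = rev (labels p1) ++ w,
   reduced_word S0 (rev (labels p1) ++ w) &
   state (rev (labels p1) ++ w) = (last (state w).1 p1, p2)].
Proof.
elim: p1 w => [|f p1 IH] w rw sw /=.
  by move: sw; case: (state w) => e p /= ->.
have fw := state_fresh rw sw.
have sfw : state (elabel f :: w) = (f, p1 ++ p2).
  by rewrite /= /next_state sw /= eqxx.
have rfw : reduced_word S0 (elabel f :: w).
  by rewrite /= fw rw asboolT //; exact: elabel_gen.
rewrite push_fresh // rev_cons cat_rcons.
have [|-> -> ->] := IH _ rfw; first by rewrite sfw.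
by rewrite sfw.
Qed.

(** From any vertex of the tree finish the current tour, step onwards once to
start a new one, and follow it until [f] or its reverse is met. *)
Lemma reach w f : reduced_word S0 w -> S0 !=set0 ->
  exists u s, [/\ size u <= (tour_bound + tour_bound).+1,
    all (fun t => `[< sym_gens S0 t >]) u, sym_gens S0 s,
    let w' := pushes w u in
    reduced_word S0 w' /\ fresh s w' &
    let x := (state (s :: pushes w u)).1 in
    x = f \/ x = ebar f].
Proof.
move=> rw [s0 S0s0].
have sz := size_state rw.
move: (follow (p1 := (state w).2) (p2 := [::]) rw).
rewrite cats0 => /(_ erefl); set p := (state w).2; set w1 := _ ++ w.
move=> [w1E rw1 stw1].
have labS q : all (fun t => `[< sym_gens S0 t >]) (labels q).
  by elim: q => //= f' q ->; rewrite andbT; apply/asboolP; exact: elabel_gen.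
(* the last letter may be repeated, as no generator is an involution *)
have [s1 [Ss1 fs1]] : exists s1, sym_gens S0 s1 /\ fresh s1 w1.
  case: w1 rw1 {w1E stw1} => [|t w1] /=; first by exists s0; split=> //; left.
  case/and3P => /asboolP St _ _; exists t; split=> //.
  exact/eqP/(gen_neqV G_free).
pose f0 := sel (erange (last (state w).1 p)) s1.
have stw2 : state (s1 :: w1) = (f0, tour f0) by rewrite /= stw1.
have [_ /(_ f) /=] := tourP f0.
rewrite /runs_through /=; case: asboolP => [f0f _|_ /= hf].
  exists (labels p), s1; rewrite w1E; split=> //.
  - rewrite size_map; apply: leq_trans sz _.
    by rewrite -addnS leq_addr.
  - by move: stw2 => /= ->.
have [p1 [x [p2 [tE xf]]]] : exists p1 x p2,
    tour f0 = p1 ++ x :: p2 /\ (x = f \/ x = ebar f).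
  elim: (tour f0) hf => //= y q IH /orP[/asboolP yf|/IH[p1 [x [p2 [-> xf]]]]].
    by exists [::], y, q.
  by exists (y :: p1), x, p2.
have rw2 : reduced_word S0 (s1 :: w1) by rewrite /= fs1 rw1 asboolT.
have st2 : (state (s1 :: w1)).2 = p1 ++ x :: p2 by rewrite stw2.
have [w2E rw3 stw3] := follow rw2 st2.
exists (labels p ++ s1 :: labels p1), (elabel x).
rewrite foldl_cat w1E /= push_fresh // w2E; split => //.
- rewrite size_cat /= !size_map addnS ltnS leq_add //.
  apply: leq_trans (tour_boundP (erange (last (state w).1 p)) Ss1).
  by rewrite -/f0 tE size_cat leq_addr.
- by rewrite all_cat /= !labS asboolT.
- exact: elabel_gen.
- by split=> //; apply: state_fresh => //; rewrite stw3.
- by rewrite /= stw3 /next_state /= eqxx.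
Qed.

End TreeColouring.

Section Recurrence.
Variables (G : groupType) (S0 : set G) (V : eqType) (Gr : rauzy_graph S0 V).
Hypothesis G_free : freely_generated_by S0.
Hypothesis S0_neq0 : S0 !=set0.
Hypothesis Gr_minimal : minimal_rauzy_graph Gr.
Implicit Types (g : G) (u : seq G) (f : edge Gr).

Definition walk u g := foldl (fun g s => s^-1 * g) g u.

Lemma walkM u g : walk u g = walk u 1 * g.
Proof.
elim: u g => [|s u IH] g /=; first by rewrite mul1g.
by rewrite /walk /= -/(walk u _) -/(walk u _) IH [in RHS]IH mulg1 mulgA.
Qed.

Lemma generated_by_walks g :
  exists2 u, all (fun t => `[< sym_gens S0 t >]) u & g = walk u 1.
Proof.
elim/(gen_indV G_free): g => [|s g Ss [u us ->]]; first by exists [::].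
exists (rcons u s^-1).
  by rewrite all_rcons us andbT; apply/asboolP; exact: sym_gensV.
by rewrite /walk foldl_rcons invgK.
Qed.

Fixpoint word_ball (ls : seq G) n : seq G :=
  if n is n'.+1 then
    word_ball ls n' ++ [seq g * s^-1 | g <- word_ball ls n', s <- ls]
  else [:: 1].

Lemma walk_word_ball ls n u :
  size u <= n -> all (mem ls) u -> walk u 1 \in word_ball ls n.
Proof.
elim: n u => [|n IH] [|s u] //.
- by rewrite inE.
- by move=> _ _ /=; rewrite mem_cat; apply/orP; left; exact: (IH [::]).
move=> /=; rewrite ltnS => un /andP[ls_s ls_u].
rewrite mem_cat; apply/orP; right.
rewrite /walk /= -/(walk u _) walkM mulg1.
by apply: allpairs_f => //; exact: IH.
Qed.

(** The colours of the normal forms. A fixed finite set [K] of displacements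
suffices to find any edge from any [g], as the number of steps given by [reach]
is bounded. *)
Lemma recurrent_colouring (vs : seq V) (ls : seq G) (v0 : V) :
  (forall v, v \in vs) -> (forall s, sym_gens S0 s -> s \in ls) ->
  exists (phi : G -> V) (K : seq G),
    (forall g s, sym_gens S0 s -> arrow Gr (phi g) s (phi (s^-1 * g))) /\
    (forall g f, exists k, [/\ k \in K, phi (k * g) = esource f &
      phi ((elabel f)^-1 * (k * g)) = erange f]).
Proof.
move=> vsP lsP.
have [s0 S0s0] := S0_neq0.
have [e0 _] := edge_ex Gr v0 (or_introl S0s0 : sym_gens S0 s0).
have /choice[sel' sel'P] (x : V * G) : exists e : edge Gr, sym_gens S0 x.2 ->
    esource e = x.1 /\ elabel e = x.2.
  have [Sx|nSx] := pselect (sym_gens S0 x.2); last by exists e0.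
  by have [e eP] := edge_ex Gr x.1 Sx; exists e.
pose sel v s := sel' (v, s).
have selP v s : sym_gens S0 s -> esource (sel v s) = v /\ elabel (sel v s) = s.
  exact: sel'P (v, s).
have /choice[tour tourP] := tour_exists Gr_minimal vsP lsP.
have [nf [nf1 nf_red nfM]] := normal_form G_free.
pose phi g := colour e0 sel tour (nf g).
have [K inK] : exists K : seq G, forall u, all (mem ls) u ->
    size u <= (tour_bound vs ls sel tour + tour_bound vs ls sel tour).+2 ->
    walk u 1 \in K.
  by eexists => u us su; apply: walk_word_ball su us.
have arr_fresh g s : sym_gens S0 s -> fresh s (nf g) ->
    nf (s^-1 * g) = s :: nf g.
  by move=> Ss fs; rewrite nfM // push_fresh.
have nf_walk u g : all (fun t => `[< sym_gens S0 t >]) u ->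
    nf (walk u g) = pushes (nf g) u.
  elim: u g => //= s u IH g /andP[/asboolP Ss Su].
  by rewrite /walk /= -/(walk u _) IH // nfM.
exists phi, K; split=> [g s Ss|g f].
- have arr h t : sym_gens S0 t -> fresh t (nf h) ->
      arrow Gr (phi h) t (phi (t^-1 * h)).
    move=> St ft; exists (state e0 sel tour (t :: nf h)).1; split.
    + exact: state_source.
    + by rewrite /phi /colour arr_fresh.
    + exact: state_top.
  have [|nfs] := boolP (fresh s (nf g)); first exact: arr.
  (* [s] cancels the last letter of [g]: use the reverse arrow *)
  have := arr (s^-1 * g) s^-1 (sym_gensV Ss).
  rewrite invgK mulVKg => H; rewrite -[s in arrow _ _ s _]invgK.
  apply/arrow_bar/H; rewrite nfM //.
  move: (nf_red g) nfs; case: (nf g) => //= t w /and3P[_ + _].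
  by rewrite negbK => tw /eqP <-; rewrite eqxx.
- have [u [s [su us Ss]]] :=
    reach e0 G_free vsP lsP selP tourP f (nf_red g) S0_neq0.
  rewrite -nf_walk //= => -[_ fw] sf.
  have ls_ls : all (mem ls) u.
    by apply/allP => t /(allP us) /asboolP; exact: lsP.
  have := arr_fresh _ _ Ss fw; set g' := walk u g => nfg'.
  have src := state_source e0 selP tourP (nf g') Ss.
  have rng : phi (s^-1 * g') = erange (state e0 sel tour (s :: nf g')).1.
    by rewrite /phi nfg'.
  have lab := state_top e0 tour selP (nf g') Ss.
  move: src rng lab; case: sf => /= -> src rng lab.
  + exists (walk u 1); rewrite -walkM -/g'; split.
    * by apply: inK => //; exact: leqW.
    * by rewrite src.
    * by rewrite lab.
  (* the reverse of [f] was met: take one step more and read it backwards *)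
  + have lab' : elabel f = s^-1 by rewrite -lab elabel_bar invgK.
    exists (walk (rcons u s) 1); split.
    * apply: inK; last by rewrite size_rcons.
      by rewrite all_rcons ls_ls andbT; exact: lsP.
    * rewrite -walkM /walk foldl_rcons -/(walk u g) -/g' rng.
      exact: erange_bar.
    * rewrite -walkM /walk foldl_rcons -/(walk u g) -/g' lab' invgK mulVKg.
      by rewrite -[phi g']src; exact: esource_bar.
Qed.

End Recurrence.

(** * The shift space of coloured and counted configurations *)

Lemma continuous_to_product (Y : topologicalType) (I : eqType)
    (K : I -> topologicalType) (f : Y -> prod_topology K) :
  (forall i, continuous (fun y => f y i)) -> continuous f.
Proof.
move=> cf y; apply/cvg_sup => i; move: y.
apply/(@continuousP _ (initial_topology (fun h : forall j, K j => h i))).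
move=> A [B oB <-]; rewrite -comp_preimage.
exact: (iffLR (continuousP _) (cf i)).
Qed.

Section ShiftSpace.
Variables (G : groupType) (S0 : set G) (V : eqType) (Gr : rauzy_graph S0 V).
Variables (vs : seq V) (K : seq G).
Hypothesis vsP : forall v, v \in vs.

(** The coordinate [(g, 0)] holds the colour of [g], coded by its position in
[vs], and the coordinate [(g, k.+1)] a counter modulo [k.+1]. *)
Definition config := prod_topology (fun _ : G * nat => nat).
HB.instance Definition _ := Topological.on config.

Implicit Types (x y : config) (g h s : G) (v : V).

Definition shift g x : config := fun i => x (i.1 * g, i.2).

Definition code v := index v vs.

Lemma code_inj : injective code.
Proof.
by move=> v w vw; rewrite -(nth_index v (vsP v)) [index _ _]vw nth_index.
Qed.

Definition bound k := if k is k'.+1 then k' else size vs.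

Definition bounded : set config := [set x | forall i, x i <= bound i.2].

Definition coloured : set config := [set x | forall g s, sym_gens S0 s ->
  exists v w,
    [/\ arrow Gr v s w, x (g, 0) = code v & x (s^-1 * g, 0) = code w]].

Definition recurrent : set config := [set x | forall g (f : edge Gr),
  exists2 k, k \in K & x (k * g, 0) = code (esource f) /\
    x ((elabel f)^-1 * (k * g), 0) = code (erange f)].

Definition counting : set config := [set x | forall g s k, S0 s ->
  x (s * g, k.+1) = (x (g, k.+1)).+1 %% k.+1].

Definition config_space := bounded `&` coloured `&` recurrent `&` counting.

Lemma coord_clopen i (P : set nat) : clopen [set x : config | P (x i)].
Proof.
have -> : [set x : config | P (x i)] = proj i @^-1` P by [].
apply: preimage_clopen; last exact: (@proj_continuous (G * nat)%type (fun=> nat) i).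
by split; [exact: discrete_open|exact: discrete_closed].
Qed.

Lemma coord2_closed i j (P : nat -> nat -> Prop) :
  closed [set x : config | P (x i) (x j)].
Proof.
have -> : [set x : config | P (x i) (x j)] =
    \bigcap_m ([set x : config | x i <> m] `|` [set x : config | P m (x j)]).
  rewrite eqEsubset; split=> [x Px m _|x Px].
    by have [<-|] := eqVneq (x i) m; [right|move/eqP; left].
  by have [|//] := Px (x i) I.
apply: closed_bigI => m _; apply: closedU.
  by have [] := @coord_clopen i [set n | n <> m].
by have [] := @coord_clopen j (P m).
Qed.

Lemma shift_continuous g : continuous (shift g).
Proof.
apply: continuous_to_product => i.
exact: (@proj_continuous (G * nat)%type (fun=> nat) (i.1 * g, i.2)).
Qed.

Lemma shiftM g h x : shift (g * h) x = shift g (shift h x).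
Proof. by apply/funext => i; rewrite /shift /= mulgA. Qed.

Lemma shift1 x : shift 1 x = x.
Proof. by apply/funext => -[g k]; rewrite /shift /= mulg1. Qed.

Lemma bounded_closed : closed bounded.
Proof.
have -> : bounded = \bigcap_i [set x : config | x i <= bound i.2].
  by rewrite eqEsubset; split=> x xb i => [_|]; exact: xb.
apply: closed_bigI => i _.
by have [] := @coord_clopen i [set n | n <= bound i.2].
Qed.

Lemma coloured_closed : closed coloured.
Proof.
have -> : coloured = \bigcap_g \bigcap_(s in sym_gens S0)
    [set x : config | exists v w, [/\ arrow Gr v s w,
      x (g, 0) = code v & x (s^-1 * g, 0) = code w]].
  rewrite eqEsubset; split=> [x xc g _ s Ss|x xc g s Ss]; first exact: xc.
  exact: (xc g I s Ss).
apply: closed_bigI => g _; apply: closed_bigI => s _.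
exact: (@coord2_closed (g, 0) (s^-1 * g, 0) (fun m n =>
  exists v w, [/\ arrow Gr v s w, m = code v & n = code w])).
Qed.

Lemma recurrent_closed : closed recurrent.
Proof.
have -> : recurrent = \bigcap_g \bigcap_f \bigcup_(k in [set` K])
    [set x : config | x (k * g, 0) = code (@esource _ _ _ Gr f) /\
      x ((elabel f)^-1 * (k * g), 0) = code (erange f)].
  rewrite eqEsubset; split=> [x xr g _ f _|x xr g f].
    by have [k kK xk] := xr g f; exists k.
  by have [k kK xk] := xr g I f I; exists k.
apply: closed_bigI => g _; apply: closed_bigI => f _.
apply: closed_bigcup => [|k _]; first exact: finite_seq.
exact: (@coord2_closed (k * g, 0) ((elabel f)^-1 * (k * g), 0) (fun m n =>
  m = code (esource f) /\ n = code (erange f))).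
Qed.

Lemma counting_closed : closed counting.
Proof.
have -> : counting = \bigcap_g \bigcap_(s in S0) \bigcap_k
    [set x : config | x (s * g, k.+1) = (x (g, k.+1)).+1 %% k.+1].
  rewrite eqEsubset; split=> [x xn g _ s S0s k _|x xn g s k S0s].
    exact: xn.
  exact: (xn g I s S0s k I).
apply: closed_bigI => g _; apply: closed_bigI => s _; apply: closed_bigI => k _.
exact: (@coord2_closed (s * g, k.+1) (g, k.+1) (fun m n => m = n.+1 %% k.+1)).
Qed.

Lemma config_space_closed : closed config_space.
Proof.
apply: closedI counting_closed; apply: closedI recurrent_closed.
exact: closedI bounded_closed coloured_closed.
Qed.

Lemma config_space_compact : compact config_space.
Proof.
apply: (@subclosed_compact _ _ bounded) => [||x [[[]]]] //.
- exact: config_space_closed.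
- apply: (@tychonoff _ (fun _ : G * nat => nat)
    (fun i => [set n | n <= bound i.2])).
  move=> i; apply: finite_compact; exact: (finite_II (bound i.2).+1).
Qed.

Lemma config_space_shift : invariant_set shift config_space.
Proof.
move=> g x [[[xb xc] xr] xn]; split; first split; first split.
- by move=> i; exact: (xb (i.1 * g, i.2)).
- by move=> h s /(xc (h * g)); rewrite mulgA.
- move=> h f; have [k kK kh] := xr (h * g) f.
  by exists k; rewrite /shift //= -!mulgA.
- by move=> h s k S0s; rewrite /shift /= -mulgA; exact: xn.
Qed.

(** The counter modulo [d.+1], where [d := m - n], moves by [d] between [s ^+ n]
and [s ^+ m]. *)
Lemma counting_aperiodic s x n m : counting x -> S0 s -> n < m ->
  bounded x -> x (s ^+ n, (m - n).+1) <> x (s ^+ m, (m - n).+1).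
Proof.
move=> xn S0s nm xb.
set d := m - n; have d0 : 0 < d by rewrite subn_gt0.
have H j : x (s ^+ (j + n), d.+1) = (x (s ^+ n, d.+1) + j) %% d.+1.
  elim: j => [|j IH].
    by rewrite addn0 modn_small // ltnS; exact: (xb (s ^+ n, d.+1)).
  by rewrite addSn expgS xn // IH -[(_ %% _).+1]addn1 modnDml addn1 addnS.
rewrite -[in RHS](subnK (ltnW nm)) H -/d => e.
have : x (s ^+ n, d.+1) + 0 == x (s ^+ n, d.+1) + d %[mod d.+1].
  rewrite -e addn0 modn_small //; exact: (xb (s ^+ n, d.+1)).
by rewrite eqn_modDl mod0n modn_small // eq_sym => /eqP d0'; rewrite d0' in d0.
Qed.

End ShiftSpace.

Section Enumerations.
Variables (G : groupType) (S0 : set G).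
Hypothesis S0_finite : finite_set S0.
Hypothesis G_free : freely_generated_by S0.

Lemma gens_enum : exists ls : seq G, forall s, sym_gens S0 s -> s \in ls.
Proof.
have /finite_seqP[ls lsE] := S0_finite.
have S0ls t : S0 t -> t \in ls by rewrite lsE.
exists (ls ++ [seq s^-1 | s <- ls]) => s; rewrite mem_cat => -[/S0ls->//|].
by move=> [t /S0ls tls <-]; rewrite (map_f _ tls) orbT.
Qed.

Lemma blocks_enum (A : nondegenerate_partition) :
  exists vs : seq A, forall v : A, v \in vs.
Proof.
have : finite_set [set: A].
  by rewrite (eq_finite_set (card_setT _)); exact: blocks_finite.
move=> /finite_seqP[vs vsE]; exists vs => v.
have : [set: A] v by [].
by rewrite vsE.
Qed.

Lemma group_enum : exists c : nat -> G, forall g, exists n, c n = g.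
Proof.
have [ls lsP] := gens_enum.
pose c n := if (unpickle n : option (nat * nat)) is Some (i, j)
  then nth 1 (word_ball ls i) j else 1.
exists c; suff H g : exists i, g \in word_ball ls i.
  move=> g; have [i gi] := H g; exists (pickle (i, index g (word_ball ls i))).
  by rewrite /c pickleK nth_index.
have [u us ->] := generated_by_walks G_free g; exists (size u).
apply: walk_word_ball => //; apply/allP => t /(allP us) /asboolP; exact: lsP.
Qed.

End Enumerations.

(** * Realising a minimal Rauzy graph *)

Lemma config_hausdorff (G : groupType) : hausdorff_space (config G).
Proof. by apply: hausdorff_product => i; exact: discrete_hausdorff. Qed.

Section Realization.
Variables (G : groupType) (S0 : set G) (A : nondegenerate_partition).
Variable Gr : rauzy_graph S0 A.
Hypothesis S0_finite : finite_set S0.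
Hypothesis S0_neq0 : S0 !=set0.
Hypothesis G_free : freely_generated_by S0.
Variables (vs : seq A) (K : seq G) (M : set (config G)).
Hypothesis vsP : forall v, v \in vs.
Hypothesis M_sub : M `<=` config_space Gr vs K.
Hypothesis M_closed : closed M.
Hypothesis M_neq0 : M !=set0.
Hypothesis M_inv : invariant_set (@shift G) M.
Hypothesis M_min : forall C, C `<=` M -> closed C -> C !=set0 ->
  invariant_set (@shift G) C -> M `<=` C.

Implicit Types (x : config G) (a b : A).

(** To be identified with the block [a]. *)
Definition cell a : set (config G) := M `&` [set x | x (1, 0) = code vs a].

Lemma M_compact : compact M.
Proof. by apply: subclosed_compact M_sub => //; exact: config_space_compact. Qed.

Lemma cell_exists x : M x -> exists a, cell a x.
Proof.
move=> Mx; have [[[_ xc] _] _] := M_sub Mx; have [s S0s] := S0_neq0.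
have [a [b [_ xa _]]] := xc 1 s (or_introl S0s).
by exists a.
Qed.

(** Recurrence places [f] at some group element; shift that element to [1]. *)
Lemma edge_seen x (f : edge Gr) : M x -> exists2 y, cell (esource f) y &
  y ((elabel f)^-1, 0) = code vs (erange f).
Proof.
move=> Mx; have [[[_ _] xr] _] := M_sub Mx; have [k _ [xk xfk]] := xr 1 f.
exists (shift k x).
  by split; [exact: M_inv|rewrite /= /shift /= mul1g -xk mulg1].
by rewrite /shift /= -xfk mulg1.
Qed.

(** If [x] is alone in [V], take [g] such that [T g] sends both [s ^+ n x] and
[s ^+ m x] into [V] for some [n < m]: these two points coincide, against
aperiodicity. *)
Lemma M_perfect V x : open V -> M x -> V x -> exists y, [/\ M y, V y & y <> x].
Proof.
move=> oV Mx Vx; apply: contrapT => isolated.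
have VM y : M y -> V y -> y = x.
  by move=> My Vy; apply: contrapT => yx; apply: isolated; exists y.
have [s S0s] := S0_neq0.
pose z n := shift (s ^+ n) x.
have Mz n : M (z n) by exact: M_inv.
have [g gP] := orbit_cluster (@shift_continuous G) (@shiftM G) M_closed
  M_inv M_min M_compact oV Mx Vx Mz.
have [n _ Vn] := gP 0; have [m nm Vm] := gP n.+1.
have gz k : V (shift g (z k)) -> z k = shift g^-1 x.
  move=> /(VM _ (M_inv g (Mz k))) <-; by rewrite -shiftM mulVg shift1.
have znm : z n = z m by rewrite (gz n Vn) (gz m Vm).
have [[[xb _] _] xn] := M_sub Mx.
apply: (counting_aperiodic xn S0s nm xb).
move/(congr1 (fun y => y (1, (m - n)%N.+1))): znm.
by rewrite /z /shift /= !mul1g.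
Qed.

Lemma cell_chart a : exists p : Omega -> config G,
  [/\ continuous p, injective p & range p = cell a].
Proof.
have [c cP] := group_enum S0_finite G_free.
pose U n : set (config G) :=
  if (unpickle n : option (nat * nat * nat)) is Some (i, k, v) then
    [set x | x (c i, k) = v] else set0.
have one_clopen : clopen [set x : config G | x (1, 0) = code vs a].
  exact: (coord_clopen (1, 0) [set code vs a]).
apply: (@cantor_chart _ _ U).
- by apply: compact_closedI; [exact: M_compact|case: one_clopen].
- have [x Mx] := M_neq0; have [s S0s] := S0_neq0.
  have [f [fa _]] := edge_ex Gr a (or_introl S0s : sym_gens S0 s).
  by have [y] := edge_seen f Mx; rewrite fa => ay _; exists y.
- move=> n; rewrite /U; case: unpickle => [[[i k] v]|]; last exact: clopen0.
  exact: (coord_clopen (c i, k) [set v]).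
- move=> x y _ _ xy; have [[g k] xygk] : exists i, x i <> y i.
    by apply/existsNP => h; apply/xy/funext.
  have [i ci] := cP g; exists (pickle (i, k, x (g, k))).
  rewrite /U pickleK ci /=; move=> [h _].
  by apply: xygk; rewrite h.
- move=> V x oV [Mx xa] Vx.
  pose W := V `&` [set x | x (1, 0) = code vs a].
  have [||y [My [Vy ya] yx]] := @M_perfect W x _ Mx.
  + by apply: openI => //; case: one_clopen.
  + by [].
  by exists y.
Qed.

(** Transport of the colour classes of [M] to the blocks of [A]. *)
Lemma omega_model : exists Phi : Omega -> config G,
  [/\ continuous Phi, injective Phi, range Phi = M &
    forall (y : Omega) a, set_val a y <-> Phi y (1, 0) = code vs a].
Proof.
pose N (b : set Omega) := \bigcup_(a in [set a : A | set_val a = b]) cell a.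
have NE a : N (set_val a) = cell a.
  rewrite eqEsubset; split=> [x [a' /val_inj -> //]|x ax]; by exists a.
have [||Phi [cPhi iPhi PhiN]] := @glue_charts (config G) A N.
- move=> b b' _ _ [x [[a <- [_ xa]] [a' <- [_ xa']]]].
  by congr set_val; apply: (code_inj vsP); rewrite -[LHS]xa -[RHS]xa'.
- by move=> b Ab; rewrite (NE (SigSub (mem_set Ab))); exact: cell_chart.
have Phi_cell (y : Omega) a : set_val a y -> cell a (Phi y).
  by move=> ay; rewrite -NE -PhiN; [exists y|exact: set_valP].
have block (y : Omega) : exists a : A, set_val a y.
  have [Acov _ _] := blocks_partition A.
  have [b Ab b_y] : cover (blocks A) id y by rewrite Acov.
  by exists (SigSub (mem_set Ab)).
exists Phi; split=> //.
- rewrite eqEsubset; split=> [_ [y _ <-]|x Mx].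
    by have [a /Phi_cell[]] := block y.
  have [a ax] := cell_exists Mx.
  have : N (set_val a) x by rewrite NE.
  by rewrite -PhiN; [case=> y _ <-; exists y|exact: set_valP].
- move=> y a; split=> [/Phi_cell[]//|ya].
  have [b b_y] := block y; have [_ yb] := Phi_cell _ _ b_y.
  by have <- : b = a by apply: (code_inj vsP); rewrite -[LHS]yb -[RHS]ya.
Qed.

(** The shift on [M], transported to [Omega]. Arrows of its graph are arrows of
[Gr] because elements of [M] are coloured along [Gr], and conversely because
all edges of [Gr] are seen in [M]. *)
Lemma Nmin_nonempty_of_minimal_shift : Nmin Gr !=set0.
Proof.
have [Phi [cPhi iPhi rPhi PhiA]] := omega_model.
have MPhi (y : Omega) : M (Phi y) by rewrite -rPhi; exists y.
have /choice[T TP] (u : G * Omega) : exists y, Phi y = shift u.1 (Phi u.2).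
  have : range Phi (shift u.1 (Phi u.2)) by rewrite rPhi; exact: M_inv.
  by case=> y _ <-; exists y.
have TV g (y : Omega) : T (g^-1, T (g, y)) = y.
  by apply: iPhi; rewrite !TP -shiftM mulVg shift1.
have TVK g (y : Omega) : T (g, T (g^-1, y)) = y.
  by apply: iPhi; rewrite !TP -shiftM mulgV shift1.
have Phi_closed D : closed D -> closed (Phi @` D).
  move=> cD; apply: compact_closed; first exact: config_hausdorff.
  apply: continuous_compact; first exact: continuous_subspaceT.
  exact: (subclosed_compact cD cantor_space_compact).
have Tcont g : continuous (fun y => T (g, y)).
  apply/continuous_closedP => D /Phi_closed cD.
  have -> : (fun y => T (g, y)) @^-1` D = Phi @^-1` (shift g @^-1` (Phi @` D)).
    rewrite eqEsubset; split=> y /=.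
      by move=> Dy; exists (T (g, y)); rewrite ?TP.
    by move=> [t Dt]; rewrite -(TP (g, y)) => /iPhi <-.
  apply: (iffLR (continuous_closedP _) cPhi).
  exact: (iffLR (continuous_closedP _) (@shift_continuous G g)).
pose h g := Homeo (TV g) (TVK g) (Tcont g) (Tcont g^-1).
have hM : monoid_morphism (h : G -> homeo).
  split=> [|g k]; apply: homeoP => y /=; apply: iPhi.
    by rewrite TP shift1.
  by rewrite !TP shiftM.
pose xi : Xi G := SigSub (mem_set hM : h \in Xi G).
have actE g (y : Omega) : act xi g y = T (g, y) by [].
have xi_min : minimal_action xi.
  move=> C cC iC.
  have [->|/eqP/set0P[y0 Cy0]] := pselect (C = set0); [by left|right].
 rewrite -subTset => y _.
  have MC : M `<=` Phi @` C.
    apply: M_min; first by move=> _ [z _ <-].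
    + exact: Phi_closed.
    + by exists (Phi y0), y0.
    + move=> g _ [z Cz <-]; exists (T (g, z)); last by rewrite TP.
      by apply: iC; exists z.
  by have [z Cz /iPhi <-] := MC _ (MPhi y).
exists (SigSub (mem_set xi_min : xi \in Xi_min G)).
rewrite /Nmin /= => a s b; rewrite arrow_rauzy_graph_of_action.
split=> [[Ss [y [ay [z b_z zy]]]]|].
- have [[[_ xc] _] _] := M_sub (MPhi y).
  have [v [w [vsw yv yw]]] := xc 1 s Ss.
  have av : v = a.
    by apply: (code_inj vsP); rewrite -[LHS]yv; apply/PhiA.
  have bw : w = b.
    apply: (code_inj vsP); rewrite -[LHS]yw mulg1.
    have <- : Phi z (1, 0) = code vs b by apply/PhiA.
    rewrite -zy actE TP /shift /= mulVg //.
  by rewrite -av -bw.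
- move=> [f [fa fb fs]]; split; first by rewrite -fs; exact: elabel_gen.
  have [y0 My0] := M_neq0.
  have [x [Mx xa] xb] := edge_seen f My0.
  have : range Phi x by rewrite rPhi.
  move=> [y _ yx]; exists y; split; first by apply/PhiA; rewrite yx -fa.
  exists (T (s^-1, y)); last by rewrite -actE; exact: actVK.
  by apply/PhiA; rewrite TP /shift /= mul1g yx -fs -fb.
Qed.

End Realization.

Lemma Nmin_nonempty (G : groupType) (S0 : set G) (A : nondegenerate_partition)
    (Gr : rauzy_graph S0 A) :
  finite_set S0 -> S0 !=set0 -> freely_generated_by S0 ->
  minimal_rauzy_graph Gr -> Nmin Gr !=set0.
Proof.
move=> S0_finite S0_neq0 G_free Gr_min.
have [vs vsP] := blocks_enum A; have [ls lsP] := gens_enum S0_finite.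
have [v0 _] : [set: A] !=set0.
  have [Acov _ _] := blocks_partition A.
  have [b Ab _] : cover (blocks A) id (fun=> true) by rewrite Acov.
  by exists (SigSub (mem_set Ab)).
have [phi [K [phi_arr phi_rec]]] :=
  recurrent_colouring G_free S0_neq0 Gr_min v0 vsP lsP.
pose u k := projT1 (cid (counter_exists G_free k)).
have uP k s g : S0 s -> u k (s * g) = ordS (u k g).
  exact: projT2 (cid (counter_exists G_free k)) s g.
pose x : config G := fun i =>
  if i.2 is k.+1 then u k i.1 : nat else code vs (phi i.1).
have Yx : config_space Gr vs K x.
  split; first split; first split.
  - move=> [g [|k]] /=; first exact: index_size.
    by rewrite /x /= -ltnS; exact: ltn_ord.
  - move=> g s Ss; exists (phi g), (phi (s^-1 * g)); split=> //; exact: phi_arr.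
  - move=> g f; have [k [kK k1 k2]] := phi_rec g f; exists k => //.
    by rewrite /x /= k1 k2.
  - by move=> g s k S0s; rewrite /x /= uP.
have [M [MY cM M0 iM Mmin]] := minimal_subsystem
  (@config_space_compact _ _ _ Gr vs K) (@config_space_closed _ _ _ Gr vs K)
  (ex_intro _ x Yx) (@config_space_shift _ _ _ Gr vs K).
exact: (Nmin_nonempty_of_minimal_shift S0_finite S0_neq0 G_free vsP MY cM M0
  iM Mmin).
Qed.

(** * The Rauzy graphs of a minimal action *)

Section MinimalAction.
Variables (G : groupType) (S0 : set G) (xi : Xi G).
Variable A : nondegenerate_partition.
Hypothesis G_free : freely_generated_by S0.
Hypothesis xi_minimal : minimal_action xi.
Local Notation Gr := (rauzy_graph_of_action S0 xi A).
Implicit Types (e f : edge Gr) (x y : Omega) (s t : G) (w u : seq G).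

(** The edge crossed when the point [y] is moved by [s^-1]. *)
Definition edge_at e y s :=
  [/\ set_val (esource e) y, set_val (erange e) (act xi s^-1 y) & elabel e = s].

Fixpoint endpoint w x :=
  if w is s :: w' then act xi s^-1 (endpoint w' x) else x.

Lemma block_inj (a b : A) x : set_val a x -> set_val b x -> a = b.
Proof.
move=> ax bx; have [_ Atriv _] := blocks_partition A.
by apply/val_inj/Atriv; [exact: set_valP..|exists x].
Qed.

Lemma edge_at_inj e f y s : edge_at e y s -> edge_at f y s -> e = f.
Proof.
move=> [ey ey' es] [fy fy' fs]; apply: edge_inj.
by rewrite es fs (block_inj ey fy) (block_inj ey' fy').
Qed.

Lemma edge_at_ex y s : sym_gens S0 s -> exists e, edge_at e y s.
Proof.
move=> Ss; have [Acov _ _] := blocks_partition A.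
have [a Aa ay] : cover (blocks A) id y by rewrite Acov.
have [b Ab b_y] : cover (blocks A) id (act xi s^-1 y) by rewrite Acov.
have : arrow Gr (SigSub (mem_set Aa)) s (SigSub (mem_set Ab)).
  rewrite arrow_rauzy_graph_of_action; split=> //.
  by exists y; split=> //; exists (act xi s^-1 y) => //; exact: actVK.
by move=> [e [ea eb es]]; exists e; rewrite /edge_at ea eb es.
Qed.

Lemma edge_at_bar e y s :
  edge_at e y s -> edge_at (ebar e) (act xi s^-1 y) s^-1.
Proof.
move=> [ey ey' es]; split; last by rewrite elabel_bar es.
- by rewrite esource_bar.
- by rewrite erange_bar invgK actVK.
Qed.

(** Reading a reduced word from its bottom letter upwards, starting at [x],
gives a reduced path of edges; its first edge [e] comes from the bottom
letter [s] and its last one from the top letter [t]. *)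
Lemma word_path e x s w t w' : edge_at e x s -> rcons w s = t :: w' ->
  reduced_word S0 (t :: w') ->
  exists p, reduced_path e p /\ edge_at (last e p) (endpoint w' x) t.
Proof.
move=> ex; elim: w t w' => [|t1 w1 IH] t w' /=.
  by case=> <- <- _; exists [::].
case=> <-{t} <-{w'} /and3P[/asboolP St1].
case E : (rcons w1 s) => [|t2 w2]; first by move: E; case: (w1).
move=> /eqP t21 rw2; have [p [ep [lp1 lp2 lp3]]] := IH _ _ E rw2.
have [f f_at] := edge_at_ex (endpoint (t2 :: w2) x) St1.
exists (rcons p f); rewrite last_rcons; split=> //.
rewrite /reduced_path rcons_path; apply/andP; split=> //.
apply/asboolP; have [f1 f2 f3] := f_at; split; first exact: block_inj lp2 f1.
by rewrite lp3 f3.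
Qed.

Lemma endpoint_push t w x :
  endpoint (push t w) x = act xi t^-1 (endpoint w x).
Proof.
by case: w => [|t' w] //=; case: eqP => [->|//]; rewrite invgK actK.
Qed.

Lemma endpoint_pushes u w x :
  endpoint (pushes w u) x = act xi (walk u 1) (endpoint w x).
Proof.
elim: u w => [|t u IH] w; first by rewrite act1.
have -> : walk (t :: u) 1 = walk u 1 * t^-1.
  by rewrite -walkM /walk /= mulg1.
by rewrite [foldl _ _ _]/= IH endpoint_push actM.
Qed.

(** One push destroys at most one of the letters at the bottom. *)
Lemma push_suffix k s t w : (exists w1, w = w1 ++ nseq k.+1 s) ->
  exists w1, push t w = w1 ++ nseq k s.
Proof.
case=> -[|c w1] -> /=.
  by case: eqP => _; [exists [::]|exists [:: t; s]].
by case: eqP => _; [exists (rcons w1 s)|exists [:: t, c & rcons w1 s]];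
  rewrite /= cat_rcons.
Qed.

Lemma pushes_suffix k s u w : (exists w1, w = w1 ++ nseq (size u + k) s) ->
  exists w1, pushes w u = w1 ++ nseq k s.
Proof. by elim: u w => [//|t u IH] w /= /push_suffix - /(_ t); exact: IH. Qed.

Lemma pushes_reduced u w : all (fun t => `[< sym_gens S0 t >]) u ->
  reduced_word S0 w -> reduced_word S0 (pushes w u).
Proof.
by elim: u w => //= t u IH w /andP[/asboolP St /IH H] rw; apply/H/push_reduced.
Qed.

Lemma nseq_reduced s n : sym_gens S0 s -> reduced_word S0 (nseq n s).
Proof.
move=> Ss; elim: n => //= n ->; rewrite asboolT //= andbT.
by case: n => //= n; apply/eqP; exact: (gen_neqV G_free).
Qed.

(** Start with more letters [s] than the word [u] of [g] can cancel, where [g]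
brings the point reached by them into the set [U] of points at which [f] is
seen. *)
Lemma graph_of_minimal_action : minimal_rauzy_graph Gr.
Proof.
move=> e f.
have Se := elabel_gen e; have Sf := elabel_gen f.
set s := elabel e in Se; set t := elabel f in Sf.
have ex_at (e' : edge Gr) : exists x, edge_at e' x (elabel e').
  have : arrow Gr (esource e') (elabel e') (erange e') by exists e'.
  rewrite arrow_rauzy_graph_of_action => -[_ [x [ex [y ey yx]]]].
  by exists x; split=> //; rewrite -yx actK.
have [x ex] := ex_at e; have [y0 fy0] := ex_at f.
pose U : set Omega := set_val (esource f) `&` act xi t^-1 @^-1` set_val (erange f).
have oU : open U.
  have oA (a : A) : open (set_val a).
    by have [] := blocks_clopen (set_valP a).
  apply: openI => //; apply: (iffLR (continuousP _) _) => //.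
  exact: homeo_fun_continuous.
have Uy0 : U y0 by have [] := fy0.
have xi_min C : C `<=` [set: Omega] -> closed C -> C !=set0 ->
    invariant_set (fun g => act xi g) C -> [set: Omega] `<=` C.
  move=> _ cC [c Cc] iC; have [|C0|->//] := xi_minimal cC.
    by move=> g _ [z Cz <-]; exact: iC.
  by rewrite C0 in Cc.
have TM g h z : act xi (g * h) z = act xi g (act xi h z) by rewrite actM.
have [g gP] := @orbit_cluster _ G (fun g => act xi g) setT
  (fun g => @homeo_fun_continuous (act xi g)) TM closedT (fun _ _ _ => I) xi_min
  (fun n => endpoint (nseq n s) x) U y0 cantor_space_compact oU I Uy0 (fun _ => I).
have [u us gE] := generated_by_walks G_free g.
have [m um Um] := gP (size u).+1.
pose w := pushes (nseq m s) u.
have rw : reduced_word S0 w.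
  by apply: pushes_reduced us _; exact: nseq_reduced.
have [w2 wE] : exists w2, w = rcons w2 s.
  have [|w1 E] := @pushes_suffix (m - size u)%N s u (nseq m s).
    by exists [::]; rewrite subnKC // ltnW.
  exists (w1 ++ nseq (m - size u)%N.-1 s).
  rewrite /w E -[in LHS](@prednK (m - size u)%N) ?subn_gt0 //.
  by rewrite -addn1 nseqD catA cats1.
have endw : endpoint w x = act xi g (endpoint (nseq m s) x).
  by rewrite endpoint_pushes -gE.
have f_at : edge_at f (endpoint w x) t.
  by rewrite endw; case: Um.
(* if the step along [f] cancels the top letter, the path ends with the
   reverse of [f] *)
have [fw|nfw] := boolP (fresh t w).
  have [||p [ep lp]] := @word_path e x s (t :: w2) t w ex.
  - by rewrite /= -wE.
  - by rewrite /= fw rw asboolT.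
  by exists p; split=> //; left; exact: edge_at_inj lp f_at.
case E : w => [|t' w']; first by rewrite E in wE; case: (w2) wE.
move: nfw; rewrite E /= negbK => /eqP t't.
have [||p [ep lp]] := @word_path e x s w2 t' w' ex.
- by rewrite -wE.
- by rewrite -E.
exists p; split=> //; right.
apply: (inv_inj (@ebarK _ _ _ Gr)); rewrite ebarK.
have := edge_at_bar lp; rewrite t't invgK => lp'.
apply: edge_at_inj f_at.
by rewrite E /= t't invgK.
Qed.

End MinimalAction.

(** * Prefix partitions and convergence of actions *)

Lemma sup_entourage (T : choiceType) (I : Type) (Tc : I -> Uniform T) (i : I)
    (E : set (T * T)) :
  @entourage (Uniform.Pack (Tc i)) E -> @entourage (sup_topology Tc) E.
Proof.
move=> entE; rewrite /entourage /= /sup_ent.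
unshelve eexists E => //.
unshelve eexists.
  by apply: finmap.fset1; exists (i, E); exact/asboolP.
  by move=> p _; rewrite in_setT.
by rewrite set_fset1 bigcap_set1.
Qed.

Section Agreement.
Implicit Types (x y z : Omega) (n m : nat).

Definition agree n x y := forall i, i < n -> x i = y i.

Lemma agree_sym n x y : agree n x y -> agree n y x.
Proof. by move=> xy i /xy. Qed.

Lemma agree_trans n y x z : agree n x y -> agree n y z -> agree n x z.
Proof. by move=> xy yz i ni; rewrite xy // yz. Qed.

Lemma agree_le m n x y : m <= n -> agree n x y -> agree m x y.
Proof. by move=> mn xy i im; apply: xy; exact: leq_trans im mn. Qed.

Lemma agree_clopen n x : clopen [set y | agree n x y].
Proof.
elim: n => [|n IH].
  have -> : [set y | agree 0 x y] = setT by rewrite eqEsubset; split.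
  exact: clopenT.
have -> : [set y | agree n.+1 x y] =
    [set y | agree n x y] `&` [set y | y n = x n].
  rewrite eqEsubset; split=> y.
    by move=> xy; split; [move=> i ni; apply: xy; exact: ltnW|rewrite /= xy].
  by move=> [xy yn] i; rewrite ltnS leq_eqVlt => /predU1P[->//|/xy].
by apply: clopenI => //; exact: cantor_coord_clopen.
Qed.

Lemma agree_nbhs n x : nbhs x [set y | agree n x y].
Proof. by apply: open_nbhs_nbhs; split=> //; have [] := agree_clopen n x. Qed.

Lemma nbhs_agree x (U : set Omega) :
  nbhs x U -> exists n, forall y, agree n x y -> U y.
Proof.
move=> xU; apply: contrapT => /forallNP noU.
have /choice[y yP] n : exists y, agree n x y /\ ~ U y.
  by have /existsNP[y /not_implyP] := noU n; exists y.
have yx : y @ \oo --> (x : Omega).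
  apply/cvg_sup => N W [V] [[B] oB <-] BxN VW.
  apply: (filterS VW); exists N.+1 => // n /= Nn.
  by rewrite /preimage /= -(yP n).1.
have [n _ nU] := yx _ xU.
by apply: (yP n).2; apply: nU => /=.
Qed.

(** Compactness of [Omega], in the form of a Lebesgue number. *)
Lemma agree_uniform (P : Omega -> Omega -> Prop) :
  (forall x, exists n, forall y z, agree n x y -> agree n x z -> P y z) ->
  exists n, forall y z, agree n y z -> P y z.
Proof.
move=> Ploc.
have /compact_near_coveringP cov := cantor_space_compact.
have [|N _ NP] := cov nat \oo (fun n y => forall z, agree n y z -> P y z) _.
  move=> x _; have [n nP] := Ploc x.
  exists ([set y | agree n x y], [set m | n <= m]).
    by split; [exact: agree_nbhs|exists n].
  move=> [y m] [/= xy nm] z yz; apply: nP => //.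
  exact: agree_trans xy (agree_le nm yz).
by exists N => y z; exact: (NP N (leqnn N) y I).
Qed.

Lemma continuous_agree (f : Omega -> Omega) m : continuous f ->
  exists n, forall y z, agree n y z -> agree m (f y) (f z).
Proof.
move=> cf; apply: agree_uniform => x.
have [n nP] := nbhs_agree (cf x _ (agree_nbhs m (f x))).
exists n => y z /nP fxy /nP fxz.
exact: agree_trans (agree_sym fxy) fxz.
Qed.

Lemma blocks_agree (A : nondegenerate_partition) : exists n,
  forall y z, agree n y z -> forall a, blocks A a -> a y -> a z.
Proof.
apply: agree_uniform => x; have [Acov Atriv _] := blocks_partition A.
have [b Ab bx] : cover (blocks A) id x by rewrite Acov.
have [ob _] := blocks_clopen Ab.
have [n nP] := nbhs_agree (open_nbhs_nbhs (conj ob bx)).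
exists n => y z /nP b_y /nP bz a Aa ay.
by have -> : a = b by apply: Atriv => //; exists y.
Qed.

Lemma entourage_agree (E : set (Omega * Omega)) :
  entourage E -> exists n, forall y z, agree n y z -> E (y, z).
Proof.
move=> entE; apply: agree_uniform => x.
have entS := entourage_split_ent entE.
have [n nP] := nbhs_agree (filterI (nbhs_entourage x entS)
  (nbhs_entourage x (entourage_inv entS))).
exists n => y z /nP[_ /xsectionP xy] /nP[/xsectionP xz _].
exact: (entourage_split x entE).
Qed.

Lemma agree_entourage n :
  entourage [set xy : Omega * Omega | agree n xy.1 xy.2].
Proof.
elim: n => [|n IH].
  by apply: filterS entourageT => xy _ i.
have ent_n : entourage [set xy : Omega * Omega | xy.1 n = xy.2 n].
  apply: (@sup_entourage _ _ _ n); exists diagonal; last by move=> [x y].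
  by rewrite uniform_discrete => _ [b _ <-]; exact/diagonalP.
apply: filterS (filterI IH ent_n) => -[x y] [/= xy xyn] i.
by rewrite ltnS leq_eqVlt => /predU1P[->//|/xy].
Qed.

Lemma homeo_nbhs_agree (f : homeo) n :
  nbhs f [set h : homeo | forall y, agree n (f y) (h y)].
Proof.
apply: (@initial_continuous _ _ homeo_to_uniform f
  [set h : {uniform Omega -> Omega} | forall y, agree n (f y) (h y)]).
apply/uniform_nbhs; eexists; split; first exact: (agree_entourage n).
by move=> h fh y; exact: fh.
Qed.

Lemma nbhs_homeo_agree (f : homeo) (U : set homeo) : nbhs f U ->
  exists n, forall h : homeo, (forall y, agree n (f y) (h y)) -> U h.
Proof.
move=> [_ [[B oB <-] Bf BU]].
have /uniform_nbhs[E [/entourage_agree[n nE] EB]] : nbhs (homeo_to_uniform f) B.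
  exact: open_nbhs_nbhs.
by exists n => h fh; apply: BU; apply: EB => y _; exact: nE.
Qed.

End Agreement.

Section ActionSpace.
Variables (G : groupType) (S0 : set G).
Hypothesis S0_finite : finite_set S0.
Hypothesis G_free : freely_generated_by S0.

Definition evaluate g (zeta : Xi_min G) : homeo := act (set_val zeta) g.

Lemma evaluate_continuous g : continuous (evaluate g).
Proof.
move=> zeta; apply: (@continuous_comp _ _ _ set_val (fun xi : Xi G => act xi g)).
  exact: initial_continuous.
apply: (@continuous_comp _ _ _ set_val (fun f : {ptws G -> homeo} => f g)).
  exact: initial_continuous.
exact: (@proj_continuous G (fun=> homeo) g).
Qed.

(** The topology of the space of actions is that of uniform convergence of each
group element, measured by the length of the common prefixes. *)
Lemma cvg_action (F : set_system (Xi_min G)) (zeta : Xi_min G) : Filter F ->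
  (forall g n, F [set eta | forall y,
    agree n (evaluate g zeta y) (evaluate g eta y)]) ->
  F --> zeta.
Proof.
move=> FF H U [_ [[_ [B oB <-] <-] Bz BU]].
apply: (filterS BU).
have : (fun eta : Xi_min G => set_val (set_val eta) : {ptws G -> homeo}) @ F -->
    (set_val (set_val zeta) : {ptws G -> homeo}).
  apply/cvg_sup => g W [_ [[C oC <-] Cz CW]].
  apply: (filterS CW).
  have [n nC] := nbhs_homeo_agree (open_nbhs_nbhs (conj oC Cz)).
  by apply: filterS (H g n) => eta; exact: nC.
by apply; apply: open_nbhs_nbhs.
Qed.

Lemma meets_agree (A : nondegenerate_partition) n (xi eta : Xi G) s (a b : A) :
  (forall y z, agree n y z -> forall a, blocks A a -> a y -> a z) ->
  (forall y, agree n (act xi s y) (act eta s y)) ->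
  Defs.meets xi a s b -> Defs.meets eta a s b.
Proof.
move=> nA near [_ [/[swap] [[y b_y <-] ay]]]; exists (act eta s y).
by split; [apply: nA (near y) _ (set_valP a) ay|exists y].
Qed.

(** If [n] digits determine the block, actions whose generators agree up to [n]
digits have the same Rauzy graph on [A]. *)
Lemma Nmin_open (A : nondegenerate_partition) (Gr : rauzy_graph S0 A) :
  open (Nmin Gr).
Proof.
rewrite openE => zeta zetaN; have [n nA] := blocks_agree A.
have [ls lsP] := gens_enum S0_finite.
have : nbhs zeta [set eta | forall s, s \in ls ->
    forall y, agree n (evaluate s zeta y) (evaluate s eta y)].
  elim: ls {lsP} => [|s ls IH].
    by apply: filterS (@filterT _ (nbhs zeta) _) => eta _ s.
  have ns : nbhs zeta [set eta | forall y,
      agree n (evaluate s zeta y) (evaluate s eta y)].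
    exact: (evaluate_continuous (homeo_nbhs_agree (evaluate s zeta) n)).
  apply: filterS (filterI ns IH) => eta [es els] t.
  by rewrite inE => /predU1P[->|/els].
apply: filterS => eta near a s b.
rewrite -(zetaN a s b) !arrow_rauzy_graph_of_action.
split=> -[Ss m]; split=> //; apply: meets_agree nA _ m => y.
  by apply: agree_sym; exact: near (lsP _ Ss) y.
exact: near (lsP _ Ss) y.
Qed.

Definition cylinder n (t : {ffun 'I_n -> bool}) : set Omega :=
  [set y | forall i : 'I_n, y i = t i].

Lemma cylinder_agree n (t : {ffun 'I_n -> bool}) x y :
  cylinder t x -> cylinder t y <-> agree n x y.
Proof.
move=> tx; split=> [ty i ni|xy i]; last by rewrite -xy.
by rewrite (tx (Ordinal ni)) (ty (Ordinal ni)).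
Qed.

Definition prefix n (x : Omega) := [ffun i : 'I_n => x i].

Lemma prefixP n x : cylinder (prefix n x) x.
Proof. by move=> i; rewrite ffunE. Qed.

Lemma cylinder_neq0 n (t : {ffun 'I_n -> bool}) : cylinder t !=set0.
Proof.
exists (fun i => if insub i is Some j then t j else true) => i.
by rewrite insubT //= => lin; congr (t _); exact: val_inj.
Qed.

Lemma cylinders_partition n : partition (range (@cylinder n)) id setT.
Proof.
split.
- by rewrite -subTset => x _; exists (cylinder (prefix n x)) => //; exact: prefixP.
- move=> _ _ [t _ <-] [u _ <-] [x [tx ux]].
  by rewrite eqEsubset; split=> y; rewrite (cylinder_agree y tx) (cylinder_agree y ux).
- by move=> _ [t _ <-]; exact: cylinder_neq0.
Qed.

Lemma cylinder_clopen n (a : set Omega) : range (@cylinder n) a -> clopen a.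
Proof.
move=> [t _ <-]; have [x tx] := cylinder_neq0 t.
have -> : cylinder t = [set y | agree n x y].
  by rewrite eqEsubset; split=> y; rewrite (cylinder_agree y tx).
exact: agree_clopen.
Qed.

Definition prefix_partition n : nondegenerate_partition :=
  @NondegeneratePartition _ (finite_image (@cylinder n) finite_finset)
    (cylinders_partition n) (@cylinder_clopen n).

(** Each point moved by [f] is followed, up to [n] digits before and after the
move, by a point moved by [h]. For generators this is what the Rauzy graph on
[prefix_partition n] remembers of an action, see [graph_nbhsP]. *)
Definition shadows n (f h : Omega -> Omega) :=
  forall y, exists2 z, agree n y z & agree n (f y) (h z).

Lemma shadows_of_meets n (xi eta : Xi G) s :
  (forall a b : prefix_partition n, Defs.meets xi a s b -> Defs.meets eta a s b) ->
  shadows n (act xi s) (act eta s).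
Proof.
move=> H y.
have cyl x : blocks (prefix_partition n) (cylinder (prefix n x)).
  by exists (prefix n x).
pose bl x : prefix_partition n := SigSub (mem_set (cyl x)).
have [|_ [/[swap] [[z yz <-] ay]]] := H (bl (act xi s y)) (bl y).
  exists (act xi s y); split; first exact: prefixP.
  by exists y => //; exact: prefixP.
exists z; first exact: (iffLR (cylinder_agree z (prefixP y)) yz).
exact: (iffLR (cylinder_agree (act eta s z) (prefixP (act xi s y))) ay).
Qed.

Lemma meets_of_shadows n (xi eta : Xi G) s (a b : prefix_partition n) :
  shadows n (act xi s) (act eta s) -> Defs.meets xi a s b -> Defs.meets eta a s b.
Proof.
move=> H [_ [/[swap] [[y b_y <-] ay]]]; have [z yz fyz] := H y.
have cyl (c : prefix_partition n) x x' : agree n x x' -> set_val c x -> set_val c x'.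
  move=> xx' cx; have [t _ tc] := set_valP c.
  have tx : cylinder t x by rewrite tc.
  have : cylinder t x' by apply/(cylinder_agree x' tx).
  by rewrite tc.
by exists (act eta s z); split; [exact: cyl ay|exists z => //; exact: cyl b_y].
Qed.

Definition graph_nbhs (zeta : Xi_min G) n : set (Xi_min G) :=
  Nmin (rauzy_graph_of_action S0 (set_val zeta) (prefix_partition n)).

Lemma graph_nbhsP zeta n eta : graph_nbhs zeta n eta <->
  forall s, sym_gens S0 s -> shadows n (evaluate s zeta) (evaluate s eta) /\
    shadows n (evaluate s eta) (evaluate s zeta).
Proof.
split=> [H s Ss|H a s b].
  split; apply: shadows_of_meets => a b m.
    have := (H a s b).2; rewrite !arrow_rauzy_graph_of_action.
    by move=> /(_ (conj Ss m)) [].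
  have := (H a s b).1; rewrite !arrow_rauzy_graph_of_action.
  by move=> /(_ (conj Ss m)) [].
rewrite !arrow_rauzy_graph_of_action.
by split=> -[Ss m]; split=> //; apply: meets_of_shadows m; have [] := H s Ss.
Qed.

Lemma graph_nbhs_le zeta m n :
  m <= n -> graph_nbhs zeta n `<=` graph_nbhs zeta m.
Proof.
have shadows_le f h : m <= n -> shadows n f h -> shadows m f h.
  by move=> mn H y; have [z yz fyz] := H y; exists z; exact: agree_le mn _.
move=> mn eta /graph_nbhsP H; apply/graph_nbhsP => s /H[h1 h2].
by split; exact: shadows_le.
Qed.

Definition graph_filter zeta := filter_from [set: nat] (graph_nbhs zeta).

Lemma graph_filter_filter zeta : Filter (graph_filter zeta).
Proof.
apply: filter_from_filter; first by exists 0.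
move=> i j _ _; exists (maxn i j) => // eta H.
by split; apply: graph_nbhs_le H; rewrite ?leq_maxl ?leq_maxr.
Qed.

(** If [z] shadows [y] to a precision at which [zeta s] is uniformly continuous,
then [zeta s y] is close to [zeta s z], which is close to [eta s y]. *)
Lemma graph_nbhs_generator zeta s n : sym_gens S0 s -> exists N,
  forall eta, graph_nbhs zeta N eta ->
    forall y, agree n (evaluate s zeta y) (evaluate s eta y).
Proof.
move=> Ss.
have [k kP] := continuous_agree n (@homeo_fun_continuous (evaluate s zeta)).
exists (maxn k n) => eta /graph_nbhsP/(_ s Ss)[_ H] y.
have [z yz fyz] := H y.
apply: agree_trans (kP y z (agree_le (leq_maxl _ _) yz)) _.
exact: agree_sym (agree_le (leq_maxr _ _) fyz).
Qed.

(** Closeness on generators extends to products by uniform continuity. *)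
Lemma graph_filter_cvg zeta : graph_filter zeta --> zeta.
Proof.
have FF := graph_filter_filter zeta.
apply: cvg_action => g.
elim/(gen_indV G_free): g => [n|s g Ss IH n].
  by apply: (@filterS _ _ FF setT) filterT => eta _ y; rewrite /evaluate !act1.
have [k kP] := continuous_agree n (@homeo_fun_continuous (evaluate s zeta)).
have [N NP] := graph_nbhs_generator zeta n Ss.
have FN : graph_filter zeta (graph_nbhs zeta N) by exists N.
apply: filterS (filterI FN (IH k)) => eta [/NP es eg] y.
rewrite /evaluate !actM; exact: agree_trans (kP _ _ (eg y)) (es _).
Qed.

Lemma Nmin_basis : basis [set U : set (Xi_min G) |
  exists (A : nondegenerate_partition) (Gr : rauzy_graph S0 A),
    minimal_rauzy_graph Gr /\ U = Nmin Gr].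
Proof.
split=> [_ [A [Gr [_ ->]]]|zeta U /graph_filter_cvg [n _ nU]].
  exact: Nmin_open.
exists (graph_nbhs zeta n) => //; split.
  exists (prefix_partition n).
  exists (rauzy_graph_of_action S0 (set_val zeta) (prefix_partition n)).
  by split=> //; apply: graph_of_minimal_action => //; exact: set_valP.
by move=> a s b.
Qed.

End ActionSpace.

Local Close Scope group_scope.

Theorem theorem4p8 (G : groupType) (S0 : set G)
    (S0_finite : finite_set S0) (S0_neq0 : S0 !=set0)
    (G_free : freely_generated_by S0) :
  (forall (A : nondegenerate_partition) (Gr : rauzy_graph S0 A),
     minimal_rauzy_graph Gr -> Nmin Gr !=set0) /\
  basis [set U : set (Xi_min G) |
    exists (A : nondegenerate_partition) (Gr : rauzy_graph S0 A),
      minimal_rauzy_graph Gr /\ U = Nmin Gr].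
Proof.
split=> [A Gr|]; first exact: Nmin_nonempty.
exact: Nmin_basis.
Qed.
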